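(* Let $A$ be a $C^*$-algebra generated by $n$ isometries $S_1,\dots,S_n$, and let $\mathcal{A}$ be the dense $*$-subalgebra of $A$ generated by $S_1,\dots,S_n$. Assume that $\mathcal{A}$ admits derivations $\partial_1,\dots,\partial_n:\mathcal{A}\to\mathcal{A}$ such that $\partial_i(S_j)=\delta_{ij}S_i$ and $\partial_i(S_j^* )=-\delta_{ij}S_j^*$ for all $i,j$. Then there is a tame differential calculus $(\Omega(\mathcal{A}),\wedge,d)$ on $\mathcal{A}$ such that: \begin{enumerate} \item $\Omega^1(\mathcal{A})$ is a free $\mathcal{A}$-module with a basis $e_1,\dots,e_n$ of central elements, and $d(e_i)=0$ for each $i=1,\dots,n$. \item $\Omega^2(\mathcal{A})$ is a free module with basis $\{e_i\wedge e_j\}_{1\le i<j\le n}$, where $\wedge:\Omega^1(\mathcal{A})\otimes_{\mathcal{A}}\Omega^1(\mathcal{A})\to\Omega^2(\mathcal{A})$ is the (right $\mathcal{A}$-linear) multiplication map of the calculus. \item The operator $d:\Omega^1(\mathcal{A})\to\Omega^2(\mathcal{A})$ is given, for $a_1,\dots,a_n\in\mathcal{A}$, by $$d\Big(\sum_{i=1}^n e_i a_i\Big)=\sum_{1\le p<q\le n} e_p\wedge e_q\Big(\sum_{i=1}^n\big(\partial_p(a_iS_i^* )\partial_q(S_i)-\partial_q(a_iS_i^* )\partial_p(S_i)\big)\Big).$$ \item The calculus admits an $\mathcal{A}$-bilinear pseudo-Riemannian metric $g_0$ given by $g_0(e_i\otimes_{\mathcal{A}} e_j)=\delta_{ij}$.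 \end{enumerate}
   Context: A differential calculus on a complex algebra $\mathcal{A}$ is a differential graded algebra $(\Omega(\mathcal{A})=\bigoplus_{k\ge0}\Omega^k(\mathcal{A}),\wedge,d)$ with $\Omega^0(\mathcal{A})=\mathcal{A}$ that is generated, as a differential graded algebra, by elements of degree zero. It is quasi-tame if: (i) $\Omega^1(\mathcal{A})$ is finitely generated projective as a right $\mathcal{A}$-module; (ii) the short exact sequence of right $\mathcal{A}$-modules $0\to\mathrm{Ker}(\wedge)\to\Omega^1(\mathcal{A})\otimes_{\mathcal{A}}\Omega^1(\mathcal{A})\to\Omega^2(\mathcal{A})\to0$ splits, so that $\Omega^1(\mathcal{A})\otimes_{\mathcal{A}}\Omega^1(\mathcal{A})=\mathrm{Ker}(\wedge)\oplus\mathcal{F}$ for some right $\mathcal{A}$-module $\mathcal{F}\cong\Omega^2(\mathcal{A})$; (iii) the idempotent $P_{\rm sym}$ on $\Omega^1(\mathcal{A})\otimes_{\mathcal{A}}\Omega^1(\mathcal{A})$ with range $\mathrm{Ker}(\wedge)$ and kernel $\mathcal{F}$ is an $\mathcal{A}$-bimodule map. Put $\sigma:=2P_{\rm sym}-1$. Let $\mathcal{Z}(\Omega^1(\mathcal{A}))=\{\omega:\ a\omega=\omega a\ \forall a\in\mathcal{A}\}$ (its elements are called central) and let $\mathcal{Z}(\mathcal{A})$ be the center of $\mathcal{A}$. A quasi-tame calculus is tame if: (1) the map $\mathcal{Z}(\Omega^1(\mathcal{A}))\otimes_{\mathcal{Z}(\mathcal{A})}\mathcal{A}\to\Omega^1(\mathcal{A})$,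 $\sum_i e_i\otimes a_i\mapsto\sum_i e_ia_i$, is an isomorphism of vector spaces; (2) $\sigma(\omega\otimes_{\mathcal{A}}\eta)=\eta\otimes_{\mathcal{A}}\omega$ for all $\omega,\eta\in\mathcal{Z}(\Omega^1(\mathcal{A}))$. A pseudo-Riemannian metric is a right $\mathcal{A}$-linear map $g:\Omega^1(\mathcal{A})\otimes_{\mathcal{A}}\Omega^1(\mathcal{A})\to\mathcal{A}$ such that $g\circ\sigma=g$ and such that $V_g:\Omega^1(\mathcal{A})\to\mathrm{Hom}_{\mathcal{A}}(\Omega^1(\mathcal{A}),\mathcal{A})$, $V_g(\omega)(\eta)=g(\omega\otimes_{\mathcal{A}}\eta)$, is an isomorphism of right $\mathcal{A}$-modules. It is bilinear if it is also left $\mathcal{A}$-linear. *)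

(* Defs.v *)
From HB Require Import structures.
From mathcomp Require Import all_boot all_order all_algebra.
From mathcomp Require Import complex freeg.
From mathcomp Require Import all_classical all_reals topology normedtype.

Set Implicit Arguments.
Unset Strict Implicit.
Unset Printing Implicit Defensive.

Import Order.TTheory GRing.Theory Num.Theory numFieldNormedType.Exports.

Local Open Scope classical_set_scope.
Local Open Scope ring_scope.

(* A right B-module is an lmodType over the converse ring B^c: x *:r b is the
   scaling b *: x, and x *:r (b * b') = (x *:r b) *:r b'. Right B-linear maps
   are the {linear _ -> _} maps over B^c. *)

Notation "x *:r b" := (@GRing.scale (GRing.converse _) _ b x)
  (at level 40, left associativity) : ring_scope.

HB.mixin Record isBimodule (L B : pzRingType) M
    of GRing.Lmodule (GRing.converse B) M := {
  lact : L -> M -> M;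
  lactA : forall a b x, lact a (lact b x) = lact (a * b) x;
  lact1 : left_id 1 lact;
  lactDr : right_distributive lact +%R;
  lactDl : forall x, {morph lact^~ x : a b / a + b};
  lact_ract : forall (a : L) (x : M) (b : B), lact a (x *:r b) = lact a x *:r b
}.

#[short(type="bimodType")]
HB.structure Definition Bimodule (L B : pzRingType) :=
  {M of GRing.Lmodule (GRing.converse B) M & isBimodule L B M}.

Notation "a *:l x" := (lact a x) (at level 40, left associativity) : ring_scope.

Section Modules.
Context (R : pzRingType).

Definition finitely_generated (M : lmodType R) : Prop :=
  exists n (g : 'I_n -> M),
    forall x, exists c : 'I_n -> R, x = \sum_(i < n) c i *: g i.

Definition projective (M : lmodType R) : Prop :=
  forall (N P : lmodType R) (p : {linear N -> P}) (f : {linear M -> P}),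
    (forall y, exists x, p x = y) ->
    exists h : {linear M -> N}, forall x, p (h x) = f x.

Definition is_basis (I : finType) (M : lmodType R) (b : I -> M) : Prop :=
  (forall x, exists c : I -> R, x = \sum_i c i *: b i) /\
  (forall c : I -> R, \sum_i c i *: b i = 0 -> forall i, c i = 0).

End Modules.

Lemma ractM (B : pzRingType) (M : lmodType B^c) (x : M) (b c : B) :
  x *:r (b * c) = (x *:r b) *:r c.
Proof. by rewrite scalerA. Qed.

(* A as an A-bimodule. *)
Section RegularBimodule.
Context (A : pzRingType).

Definition regbim : Type := (A^c)^o.
HB.instance Definition _ := GRing.Lmodule.on regbim.

Definition reg_lact (a : A) (x : regbim) : regbim := (a * (x : A) : A).

Fact reg_lactA a b x : reg_lact a (reg_lact b x) = reg_lact (a * b) x.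
Proof. exact: (@mulrA A). Qed.
Fact reg_lact1 : left_id 1 reg_lact. Proof. exact: (@mul1r A). Qed.
Fact reg_lactDr : right_distributive reg_lact +%R.
Proof. exact: (@mulrDr A). Qed.
Fact reg_lactDl x : {morph reg_lact^~ x : a b / a + b}.
Proof. move=> a b; exact: (@mulrDl A). Qed.
Fact reg_lact_ract (a : A) (x : regbim) (b : A) :
  reg_lact a (x *:r b) = reg_lact a x *:r b.
Proof. exact: (@mulrA A). Qed.

HB.instance Definition _ := isBimodule.Build A A regbim
  reg_lactA reg_lact1 reg_lactDr reg_lactDl reg_lact_ract.

End RegularBimodule.

Section Span.
Context (V : zmodType) (X : set V).

Definition subgroup (B : set V) : Prop :=
  B 0 /\ forall x y, B x -> B y -> B (x - y).

Definition zspan : {pred V} :=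
  fun x => `[< forall B : set V, subgroup B -> X `<=` B -> B x >].

Fact zspan_closed : zmod_closed zspan.
Proof.
split=> [|x y /asboolP hx /asboolP hy]; apply/asboolP=> B hB XB.
  by case: hB.
by apply: (hB.2); [apply: hx | apply: hy].
Qed.

HB.instance Definition _ := GRing.isZmodClosed.Build V zspan zspan_closed.

Lemma mem_zspan x : X x -> x \in zspan.
Proof. by move=> Xx; apply/asboolP=> B _; apply. Qed.

End Span.

(* The tensor product of M and N over R: the quotient of the free abelian     *)
(* group on M * N by the subgroup generated by the usual relations.           *)
Section Tensor.
Context (R : pzRingType).

Section Def.
Context (B : pzRingType) (M : lmodType R^c) (N : bimodType R B).

Definition fpair (x : M) (y : N) : {freeg (M * N) / int} := << (x, y) >>.

Definition tensor_rel : set {freeg (M * N) / int} := fun u =>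
  [\/ exists x x' y, u = fpair (x + x') y - (fpair x y + fpair x' y),
      exists x y y', u = fpair x (y + y') - (fpair x y + fpair x y') |
      exists x (r : R) y, u = fpair (x *:r r) y - fpair x (r *:l y)].

Definition tensor : Type := Quotient.quot (zspan tensor_rel).
HB.instance Definition _ := GRing.Zmodule.on tensor.

Definition tpi (u : {freeg (M * N) / int}) : tensor :=
  \pi_(Quotient.quot (zspan tensor_rel))%qT u.

Definition tens (x : M) (y : N) : tensor := tpi (fpair x y).

Definition balanced (G : zmodType) (f : M -> N -> G) : Prop :=
  [/\ forall x x' y, f (x + x') y = f x y + f x' y,
      forall x y y', f x (y + y') = f x y + f x y' &
      forall x (r : R) y, f (x *:r r) y = f x (r *:l y)].


Definition tlift (G : zmodType) (f : M -> N -> G) (u : tensor) : G :=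
  fglift (fun p : M * N => f p.1 p.2 : zmodule G)
    (repr (u : Quotient.quot (zspan tensor_rel)) : {freeg (M * N) / int}).

Fact tpiB : {morph tpi : u v / u - v}.
Proof. exact: (raddfB \pi_(Quotient.quot (zspan tensor_rel))%qT). Qed.
Fact tpiD : {morph tpi : u v / u + v}.
Proof. exact: (raddfD \pi_(Quotient.quot (zspan tensor_rel))%qT). Qed.
Fact tpi0 : tpi 0 = 0.
Proof. exact: (raddf0 \pi_(Quotient.quot (zspan tensor_rel))%qT). Qed.
Fact tpiN : {morph tpi : u / - u}.
Proof. exact: (raddfN \pi_(Quotient.quot (zspan tensor_rel))%qT). Qed.

Fact tpi_eq u v : u - v \in zspan tensor_rel -> tpi u = tpi v.
Proof.
by move=> h; apply/eqP; rewrite -(Quotient.idealrBE (zspan tensor_rel)).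
Qed.

Lemma tensDl x x' y : tens (x + x') y = tens x y + tens x' y.
Proof.
rewrite /tens -tpiD; apply/tpi_eq/mem_zspan.
by apply: Or31; exists x, x', y.
Qed.

Lemma tensDr x y y' : tens x (y + y') = tens x y + tens x y'.
Proof.
rewrite /tens -tpiD; apply/tpi_eq/mem_zspan.
by apply: Or32; exists x, y, y'.
Qed.

Lemma tensM x (r : R) y : tens (x *:r r) y = tens x (r *:l y).
Proof. by apply/tpi_eq/mem_zspan; apply: Or33; exists x, r, y. Qed.

Lemma tensor_ind (P : tensor -> Prop) :
  P 0 -> (forall u v, P u -> P v -> P (u - v)) -> (forall x y, P (tens x y)) ->
  forall u, P u.
Proof.
move=> P0 PB Pt u.
have PN v : P v -> P (- v) by move=> Pv; rewrite -[- v]add0r; apply: PB.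
have PD v w : P v -> P w -> P (v + w).
  by move=> Pv Pw; rewrite -[w]opprK; apply/PB/PN.
have -> : u = tpi (repr (u : Quotient.quot (zspan tensor_rel))).
  by rewrite /tpi reprK.
move: (repr _) => D; rewrite -(freeg_sumE D).
elim: (dom D) => [|z s IHs]; first by rewrite big_nil tpi0.
rewrite big_cons tpiD; apply: (PD) => //.
have PMn k : P (tpi (<< z >> *+ k)).
  elim: k => [|k IHk]; first by rewrite mulr0n tpi0.
  by rewrite mulrS tpiD; apply: PD => //; case: (z) => x y; apply: Pt.
have -> : << coeff z D *g z >> = << z >> *~ coeff z D :> {freeg (M * N) / int}.
  by rewrite freegU_mulz intz.
case: (coeff z D) => k; [exact: PMn|]; rewrite NegzE mulrNz tpiN.
exact/PN/PMn.
Qed.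

Section Lift.
Context (G : zmodType) (f : M -> N -> G) (f_bal : balanced f).

Let F := fglift (fun p : M * N => f p.1 p.2 : zmodule G).

Let FB : {morph F : u v / u - v >-> u - v}. Proof. exact: lift_is_additive. Qed.
Let F0 : F 0 = 0. Proof. by rewrite -(subrr 0) FB subrr. Qed.
Let FN u : F (- u) = - F u. Proof. by rewrite -[- u]sub0r FB F0 sub0r. Qed.
Let FD u v : F (u + v) = F u + F v.
Proof. by rewrite -{1}[v]opprK FB FN opprK. Qed.
Let Fpair x y : F (fpair x y) = f x y.
Proof. by rewrite /F /fpair liftU scale1r. Qed.

Let F_null u : u \in zspan tensor_rel -> F u = 0.
Proof.
case: f_bal => fDl fDr fM /asboolP/(_ [set v | F v = 0]); apply.
  by split=> [|x y Fx Fy]; [exact: F0 | rewrite /= FB Fx Fy subrr].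
move=> v [[x [x' [y ->]]]|[x [y [y' ->]]]|[x [r [y ->]]]].
all: rewrite /=.
- by rewrite FB FD !Fpair fDl subrr.
- by rewrite FB FD !Fpair fDr subrr.
- by rewrite FB !Fpair fM subrr.
Qed.

Let tlift_pi u : tlift f (tpi u) = F u.
Proof.
apply/eqP; rewrite -subr_eq0 -FB; apply/eqP/F_null.
by rewrite (Quotient.idealrBE (zspan tensor_rel)) reprK.
Qed.

Lemma tlift_tens x y : tlift f (tens x y) = f x y.
Proof. by rewrite tlift_pi Fpair. Qed.

Lemma tliftB : {morph tlift f : u v / u - v}.
Proof.
move=> u v.
rewrite -[u](reprK (u : Quotient.quot (zspan tensor_rel))).
rewrite -[v](reprK (v : Quotient.quot (zspan tensor_rel))).
by rewrite -[X in tlift f X]tpiB !tlift_pi FB.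
Qed.

Lemma tlift0 : tlift f 0 = 0.
Proof. by rewrite -(subrr (0 : tensor)) tliftB subrr. Qed.

Lemma tliftD : {morph tlift f : u v / u + v}.
Proof.
by move=> u v; rewrite -[v in LHS]opprK -[- v]sub0r !tliftB tlift0 sub0r opprK.
Qed.

Lemma tlift_uniq (h : tensor -> G) :
  {morph h : u v / u - v} -> (forall x y, h (tens x y) = f x y) -> h =1 tlift f.
Proof.
move=> hB ht; apply: tensor_ind => [|u v hu hv|x y].
- by rewrite -(subrr (0 : tensor)) hB tliftB !subrr.
- by rewrite hB tliftB hu hv.
- by rewrite ht tlift_tens.
Qed.

End Lift.

Lemma tens_balanced : balanced tens.
Proof. by split; [exact: tensDl | exact: tensDr | exact: tensM]. Qed.

Definition tract (b : B^c) : tensor -> tensor :=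
  tlift (fun x y => tens x (b *: y)).

Fact tract_balanced (b : B^c) : balanced (fun x y => tens x (b *: y)).
Proof.
split=> [x x' y|x y y'|x r y]; first exact: tensDl.
  by rewrite scalerDr tensDr.
by rewrite tensM lact_ract.
Qed.

Lemma tract_tens b x y : tract b (tens x y) = tens x (b *: y).
Proof. exact/tlift_tens/tract_balanced. Qed.

Fact tractDr b : {morph tract b : u v / u + v}.
Proof. exact/tliftD/tract_balanced. Qed.

Fact tract0 b : tract b 0 = 0.
Proof. exact/tlift0/tract_balanced. Qed.

Fact tractB b : {morph tract b : u v / u - v}.
Proof. exact/tliftB/tract_balanced. Qed.

Fact tractA a b u : tract a (tract b u) = tract (a * b) u.
Proof.
move: u; apply: tensor_ind => [|u v Pu Pv|x y]; first by rewrite !tract0.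
  by rewrite !tractB Pu Pv.
by rewrite !tract_tens scalerA.
Qed.

Fact tract1 : left_id 1 tract.
Proof.
apply: tensor_ind => [|u v Pu Pv|x y]; first by rewrite tract0.
  by rewrite tractB Pu Pv.
by rewrite tract_tens scale1r.
Qed.

Fact tractDl u : {morph tract^~ u : a b / a + b}.
Proof.
move=> a b; move: u; apply: tensor_ind => [|u v Pu Pv|x y].
- by rewrite !tract0 addr0.
- by rewrite !tractB Pu Pv opprD addrACA.
- by rewrite !tract_tens scalerDl tensDr.
Qed.

HB.instance Definition _ := GRing.Zmodule_isLmodule.Build B^c tensor
  tractA tract1 tractDr tractDl.

Lemma tens_ract x y (b : B) : tens x y *:r b = tens x (y *:r b).
Proof. exact: tract_tens. Qed.

Lemma tlift_linear (P : lmodType B^c) (f : M -> N -> P) :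
  balanced f -> (forall x y (b : B), f x (y *:r b) = f x y *:r b) ->
  linear (tlift f).
Proof.
move=> f_bal fZ a u v; rewrite tliftD //; congr (_ + _); move: u {v}.
apply: tensor_ind => [|u v Pu Pv|x y].
- by rewrite scaler0 !tlift0 // scaler0.
- by rewrite scalerBr !tliftB // Pu Pv scalerBr.
- by rewrite tens_ract !tlift_tens // fZ.
Qed.

End Def.

Section LeftAction.
Context (L B : pzRingType) (M : bimodType L R) (N : bimodType R B).

Definition tlact (a : L) : tensor M N -> tensor M N :=
  tlift (fun x y => tens (a *:l x) y).

Fact tlact_balanced (a : L) :
  balanced (fun (x : M) (y : N) => tens (a *:l x) y).
Proof.
split=> [x x' y|x y y'|x r y]; last by rewrite lact_ract tensM.
  by rewrite lactDr tensDl.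
exact: tensDr.
Qed.

Lemma tlact_tens a x y : tlact a (tens x y) = tens (a *:l x) y.
Proof. exact: tlift_tens (tlact_balanced a) x y. Qed.

Fact tlactDr : right_distributive tlact +%R.
Proof. by move=> a; apply/tliftD/tlact_balanced. Qed.

Fact tlact0 a : tlact a 0 = 0.
Proof. exact/tlift0/tlact_balanced. Qed.

Fact tlactB a : {morph tlact a : u v / u - v}.
Proof. exact/tliftB/tlact_balanced. Qed.

Fact tlactA a b u : tlact a (tlact b u) = tlact (a * b) u.
Proof.
move: u; apply: tensor_ind => [|u v Pu Pv|x y]; first by rewrite !tlact0.
  by rewrite !tlactB Pu Pv.
by rewrite !tlact_tens lactA.
Qed.

Fact tlact1 : left_id 1 tlact.
Proof.
apply: tensor_ind => [|u v Pu Pv|x y]; first by rewrite tlact0.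
  by rewrite tlactB Pu Pv.
by rewrite tlact_tens lact1.
Qed.

Fact tlactDl u : {morph tlact^~ u : a b / a + b}.
Proof.
move=> a b; move: u; apply: tensor_ind => [|u v Pu Pv|x y].
- by rewrite !tlact0 addr0.
- by rewrite !tlactB Pu Pv opprD addrACA.
- by rewrite !tlact_tens lactDl tensDl.
Qed.

Fact tlact_ract (a : L) (u : tensor M N) (b : B) :
  tlact a (u *:r b) = tlact a u *:r b.
Proof.
move: u; apply: tensor_ind => [|u v Pu Pv|x y].
- by rewrite scaler0 tlact0 scaler0.
- by rewrite scalerBr !tlactB Pu Pv scalerBr.
- by rewrite tens_ract !tlact_tens tens_ract.
Qed.

HB.instance Definition _ := isBimodule.Build L B (tensor M N)
  tlactA tlact1 tlactDr tlactDl tlact_ract.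

Lemma lact_tens a x y : a *:l tens x y = tens (a *:l x) y.
Proof. exact: tlact_tens. Qed.

End LeftAction.
End Tensor.

Notation "x \otimes y" := (tens x y)
  (at level 40, left associativity) : ring_scope.

Section Center.
Context (A : nzRingType).

Definition center : {pred A} := fun z => `[< forall a : A, z * a = a * z >].

Fact center_closed : subring_closed center.
Proof.
split=> [|x y /asboolP hx /asboolP hy|x y /asboolP hx /asboolP hy].
- by apply/asboolP=> a; rewrite mul1r mulr1.
- by apply/asboolP=> a; rewrite mulrBl mulrBr hx hy.
- by apply/asboolP=> a; rewrite -mulrA hy mulrA hx mulrA.
Qed.

HB.instance Definition _ := GRing.isSubringClosed.Build A center center_closed.

Definition centerRing : Type := {z : A | z \in center}.
HB.instance Definition _ := SubChoice.on centerRing.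
HB.instance Definition _ :=
  [SubChoice_isSubNzRing of centerRing by <:].

(* A as a Z(A)-A-bimodule, on a separate alias because the left scalars differ
   from those of regbim. *)
Definition center_bim : Type := (A^c)^o.
HB.instance Definition _ := GRing.Lmodule.on center_bim.

Definition center_lact (z : centerRing) (a : center_bim) : center_bim :=
  (val z * (a : A) : A).

Fact center_lactA a b x :
  center_lact a (center_lact b x) = center_lact (a * b) x.
Proof. exact: (@mulrA A). Qed.
Fact center_lact1 : left_id 1 center_lact. Proof. exact: (@mul1r A). Qed.
Fact center_lactDr : right_distributive center_lact +%R.
Proof. by move=> z; exact: (@mulrDr A). Qed.
Fact center_lactDl x : {morph center_lact^~ x : a b / a + b}.
Proof. move=> a b; exact: (@mulrDl A). Qed.
Fact center_lact_ract (a : centerRing) (x : center_bim) (b : A) :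
  center_lact a (x *:r b) = center_lact a x *:r b.
Proof. exact: (@mulrA A). Qed.

HB.instance Definition _ := isBimodule.Build centerRing A center_bim
  center_lactA center_lact1 center_lactDr center_lactDl center_lact_ract.

Context (M : bimodType A A).

Definition central : {pred M} :=
  fun x => `[< forall a : A, a *:l x = x *:r a >].

Fact lact0r (a : A) : a *:l (0 : M) = 0.
Proof. by apply: (addrI (a *:l 0)); rewrite -lactDr !addr0. Qed.

Fact lactBr (a : A) (x y : M) : a *:l (x - y) = a *:l x - a *:l y.
Proof. by apply: (addIr (a *:l y)); rewrite -lactDr !subrK. Qed.

Fact central_closed : zmod_closed central.
Proof.
split=> [|x y /asboolP hx /asboolP hy]; apply/asboolP=> a.
  by rewrite lact0r scaler0.
by rewrite lactBr scalerBr hx hy.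
Qed.

HB.instance Definition _ := GRing.isZmodClosed.Build M central central_closed.

Definition centralSub : Type := {x : M | x \in central}.
HB.instance Definition _ := SubChoice.on centralSub.
HB.instance Definition _ := [SubChoice_isSubZmodule of centralSub by <:].

Fact central_ract (z : centerRing) (x : centralSub) :
  val x *:r val z \in central.
Proof.
apply/asboolP=> a; have /asboolP/(_ a) hx := valP x.
have /asboolP/(_ a) hz := valP z.
by rewrite lact_ract hx -!ractM hz.
Qed.

Definition centralSub_ract (z : centerRing^c) (x : centralSub) : centralSub :=
  Sub (val x *:r val (z : centerRing)) (central_ract z x).

Fact centralSub_ractA a b x :
  centralSub_ract a (centralSub_ract b x) = centralSub_ract (a * b) x.
Proof. by apply: val_inj; rewrite /= -ractM. Qed.
Fact centralSub_ract1 : left_id 1 centralSub_ract.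
Proof. by move=> x; apply: val_inj; rewrite /= (scale1r (val x)). Qed.
Fact centralSub_ractDr : right_distributive centralSub_ract +%R.
Proof. by move=> a x y; apply: val_inj; rewrite /= scalerDr. Qed.
Fact centralSub_ractDl x : {morph centralSub_ract^~ x : a b / a + b}.
Proof. by move=> a b; apply: val_inj; rewrite /= (scalerDl (val x)). Qed.

HB.instance Definition _ := GRing.Zmodule_isLmodule.Build centerRing^c
  centralSub centralSub_ractA centralSub_ract1 centralSub_ractDr
  centralSub_ractDl.

(* The map e \otimes a |-> e a from Z(M) \otimes_Z(A) A to M; it is right
   A-linear, hence linear over the base field when A is an algebra. *)
Definition central_mul : tensor centralSub center_bim -> M :=
  tlift (fun (e : centralSub) (a : center_bim) => val e *:r (a : A)).

Fact central_mul_balanced :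
  balanced (fun (e : centralSub) (a : center_bim) => val e *:r (a : A)).
Proof.
split=> [e e' a|e a a'|e z a]; first by rewrite /= scalerDr.
  by rewrite (scalerDl (val e)).
by rewrite /= -ractM.
Qed.

Lemma central_mul_tens (e : centralSub) (a : center_bim) :
  central_mul (e \otimes a) = val e *:r (a : A).
Proof. exact: tlift_tens central_mul_balanced e a. Qed.

Fact central_mul_linear : linear central_mul.
Proof.
apply: tlift_linear central_mul_balanced _ => e a b.
by rewrite -ractM.
Qed.

HB.instance Definition _ := GRing.isLinear.Build A^c
  (tensor centralSub center_bim) M _ central_mul central_mul_linear.

End Center.

(* Hom_A(M, A), the right A-linear maps from a bimodule M to A, as a right    *)
(* A-module: (f *:r a) x = f (a *:l x).                                       *)
Section Dual.
Context (A : pzRingType) (M : bimodType A A).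

Definition rlinear : {pred M -> regbim A} := fun f => `[< linear f >].

Fact rlinear_closed : zmod_closed rlinear.
Proof.
split=> [|f g /asboolP hf /asboolP hg]; apply/asboolP=> a x y.
  by rewrite [LHS]/(0 : regbim A) scaler0 addr0.
rewrite -[LHS]/(f (a *: x + y) - g (a *: x + y)).
rewrite -[RHS]/(a *: (f x - g x) + (f y - g y)).
by rewrite hf hg scalerBr opprD addrACA.
Qed.

HB.instance Definition _ :=
  GRing.isZmodClosed.Build (M -> regbim A) rlinear rlinear_closed.

Definition dual : Type := {f : M -> regbim A | f \in rlinear}.
HB.instance Definition _ := SubChoice.on dual.
HB.instance Definition _ := [SubChoice_isSubZmodule of dual by <:].

Fact dual_ract_proof (a : A) (f : dual) :
  (fun x => val f (a *:l x)) \in rlinear.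
Proof.
apply/asboolP=> b x y; have /asboolP hf := valP f.
by rewrite lactDr -[b *: x]/(x *:r b) lact_ract hf.
Qed.

Definition dual_ract (a : A^c) (f : dual) : dual :=
  Sub (fun x => val f ((a : A) *:l x)) (dual_ract_proof a f).

Fact dual_ractA a b f : dual_ract a (dual_ract b f) = dual_ract (a * b) f.
Proof. by apply/val_inj/funext=> x /=; rewrite lactA. Qed.
Fact dual_ract1 : left_id 1 dual_ract.
Proof. by move=> f; apply/val_inj/funext=> x /=; rewrite lact1. Qed.
Fact dual_ractDr : right_distributive dual_ract +%R.
Proof. by move=> a f g; apply/val_inj/funext=> x. Qed.
Fact dual_ractDl f : {morph dual_ract^~ f : a b / a + b}.
Proof.
move=> a b; apply/val_inj/funext=> x /=; have /asboolP hf := valP f.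
rewrite lactDl -[LHS]/(val f _) -[(a : A) *:l x in LHS]scale1r hf scale1r.
by [].
Qed.

HB.instance Definition _ := GRing.Zmodule_isLmodule.Build A^c dual
  dual_ractA dual_ract1 dual_ractDr dual_ractDl.

Lemma dual_ractE (f : dual) (a : A) x : val (f *:r a) x = val f (a *:l x).
Proof. by []. Qed.

Context (g : {linear tensor M M -> regbim A}).

Fact metric_map_proof (x : M) : (fun y => g (x \otimes y)) \in rlinear.
Proof.
apply/asboolP=> a y z.
by rewrite tensDr -[a *: y]/(y *:r a) -tens_ract linearD linearZ.
Qed.

(* The map V_g. *)
Definition metric_map (x : M) : dual :=
  Sub (fun y => g (x \otimes y)) (metric_map_proof x).

End Dual.

(* Graded objects are families of homogeneous components. The product takes   *)
(* a proof that the degree of its value is the sum of the degrees of its      *)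
(* arguments, so that associativity needs no transport; such proofs are       *)
(* unique.                                                                    *)
Record dga (K : fieldType) := Dga {
  component :> nat -> lmodType K;
  wedge : forall i j k : nat, (i + j)%N = k ->
    component i -> component j -> component k;
  dga1 : component 0%N;
  diff : forall k : nat, {linear component k -> component k.+1};
  wedge_linl : forall i j k (e : (i + j)%N = k) y,
    linear (fun x => wedge e x y);
  wedge_linr : forall i j k (e : (i + j)%N = k) x, linear (wedge e x);
  wedgeA : forall i j k ij jk ijk (e1 : (i + j)%N = ij) (e2 : (ij + k)%N = ijk)
      (e3 : (j + k)%N = jk) (e4 : (i + jk)%N = ijk) x y z,
    wedge e4 x (wedge e3 y z) = wedge e2 (wedge e1 x y) z;
  wedge1l : forall k (e : (0 + k)%N = k) x, wedge e dga1 x = x;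
  wedge1r : forall k (e : (k + 0)%N = k) x, wedge e x dga1 = x;
  diff_diff : forall k x, diff k.+1 (diff k x) = 0;
  diff_wedge : forall i j k (e : (i + j)%N = k) (e1 : (i.+1 + j)%N = k.+1)
      (e2 : (i + j.+1)%N = k.+1) x y,
    diff k (wedge e x y) =
      wedge e1 (diff i x) y + (- 1) ^+ i *: wedge e2 x (diff j y)
}.

Arguments diff {K d} k.

Definition sub_dga (K : fieldType) (Om : dga K) (B : forall k, set (Om k)) :
    Prop :=
  [/\ B 0%N (dga1 Om),
      forall k, B k 0 /\
        forall (c : K) x y, B k x -> B k y -> B k (c *: x + y),
      forall i j k (e : (i + j)%N = k) x y,
        B i x -> B j y -> B k (wedge e x y) &
      forall k x, B k x -> B k.+1 (diff k x)].

Definition generated_in_degree0 (K : fieldType) (Om : dga K) : Prop :=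
  forall B : (forall k, set (Om k)), sub_dga B ->
    (forall x, B 0%N x) -> forall k x, B k x.

(* The identification of A with the degree 0 component is explicit: deg0.     *)
Record calculus (K : fieldType) (A : algType K) := Calculus {
  calculus_dga :> dga K;
  deg0 : {linear A -> calculus_dga 0%N};
  deg0_bij : bijective deg0;
  deg0_1 : deg0 1 = dga1 calculus_dga;
  deg0M : forall a b, deg0 (a * b) =
    wedge (erefl : (0 + 0)%N = 0%N) (deg0 a) (deg0 b);
  calculus_gen : generated_in_degree0 calculus_dga
}.

Section Forms.
Context (K : fieldType) (A : algType K) (Om : calculus A).

Definition forms (k : nat) : Type := Om k.

Section Bimodule.
Context (k : nat).

HB.instance Definition _ := GRing.Zmodule.on (forms k).

Definition form_ract (a : A^c) (x : forms k) : forms k :=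
  wedge (addn0 k) x (deg0 Om a).

Definition form_lact (a : A) (x : forms k) : forms k :=
  wedge (add0n k) (deg0 Om a) x.

Fact form_ractA a b x : form_ract a (form_ract b x) = form_ract (a * b) x.
Proof.
rewrite /form_ract (deg0M Om b a).
by rewrite (wedgeA (addn0 k) (addn0 k) erefl (addn0 k)).
Qed.
Fact form_ract1 : left_id 1 form_ract.
Proof. by move=> x; rewrite /form_ract (deg0_1 Om) wedge1r. Qed.
Fact form_ractDr : right_distributive form_ract +%R.
Proof.
move=> a x y; rewrite /form_ract.
by have := wedge_linl (addn0 k) (deg0 Om a) 1 x y; rewrite !scale1r.
Qed.
Fact form_ractDl x : {morph form_ract^~ x : a b / a + b}.
Proof.
move=> a b; rewrite /form_ract (linearD (deg0 Om)).
have := wedge_linr (addn0 k) x 1 (deg0 Om a) (deg0 Om b).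
by rewrite !scale1r.
Qed.

HB.instance Definition _ := GRing.Zmodule_isLmodule.Build A^c (forms k)
  form_ractA form_ract1 form_ractDr form_ractDl.

Fact form_lactA a b x : form_lact a (form_lact b x) = form_lact (a * b) x.
Proof.
rewrite /form_lact (deg0M Om a b).
exact: wedgeA.
Qed.
Fact form_lact1 : left_id 1 form_lact.
Proof. by move=> x; rewrite /form_lact (deg0_1 Om) wedge1l. Qed.
Fact form_lactDr : right_distributive form_lact +%R.
Proof.
move=> a x y; rewrite /form_lact.
by have := wedge_linr (add0n k) (deg0 Om a) 1 x y; rewrite !scale1r.
Qed.
Fact form_lactDl x : {morph form_lact^~ x : a b / a + b}.
Proof.
move=> a b; rewrite /form_lact (linearD (deg0 Om)).
have := wedge_linl (add0n k) x 1 (deg0 Om a) (deg0 Om b).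
by rewrite !scale1r.
Qed.
Fact form_lact_ract (a : A) (x : forms k) (b : A) :
  form_lact a (x *:r b) = form_lact a x *:r b.
Proof. exact: wedgeA. Qed.

HB.instance Definition _ := isBimodule.Build A A (forms k)
  form_lactA form_lact1 form_lactDr form_lactDl form_lact_ract.

End Bimodule.

Definition wedge11 (x y : forms 1) : forms 2 :=
  wedge (erefl : (1 + 1)%N = 2%N) x y.

Fact wedge11_balanced : balanced wedge11.
Proof.
split=> [x x' y|x y y'|x a y].
- by have := wedge_linl erefl y 1 x x'; rewrite !scale1r.
- by have := wedge_linr erefl x 1 y y'; rewrite !scale1r.
- exact/esym/wedgeA.
Qed.

Definition wedge2 : tensor (forms 1) (forms 1) -> forms 2 := tlift wedge11.

Fact wedge2_linear : linear wedge2.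
Proof.
apply: tlift_linear wedge11_balanced _ => x y a.
exact: wedgeA.
Qed.

HB.instance Definition _ := GRing.isLinear.Build A^c
  (tensor (forms 1) (forms 1)) (forms 2) _ wedge2 wedge2_linear.

Lemma wedge2_tens x y : wedge2 (x \otimes y) = wedge11 x y.
Proof. exact: tlift_tens wedge11_balanced x y. Qed.

(* The differential from degree 1 to degree 2. It is linear over K only. *)
Definition dform (x : forms 1) : forms 2 := diff 1 x.

(* The sequence 0 -> Ker wedge2 -> forms 1 \otimes forms 1 -> forms 2 -> 0 is
   split by qt_split, and the complement F of Ker wedge2 is range qt_split. *)
Record quasi_tame := QuasiTame {
  qt_fin_gen : finitely_generated (forms 1);
  qt_proj : projective (forms 1);
  qt_split : {linear forms 2 -> tensor (forms 1) (forms 1)};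
  qt_splitK : cancel qt_split wedge2;
  Psym : {linear tensor (forms 1) (forms 1) -> tensor (forms 1) (forms 1)};
  Psym_idem : forall u, Psym (Psym u) = Psym u;
  Psym_range : range Psym = [set u | wedge2 u = 0];
  Psym_ker : [set u | Psym u = 0] = range qt_split;
  Psym_lact : forall (a : A) u, Psym (a *:l u) = a *:l Psym u
}.

Definition sigma (Q : quasi_tame) (u : tensor (forms 1) (forms 1)) :
  tensor (forms 1) (forms 1) := Psym Q u *+ 2 - u.

Definition tame (Q : quasi_tame) : Prop :=
  bijective (@central_mul A (forms 1)) /\
  (forall x y : forms 1, x \in @central A (forms 1) ->
     y \in @central A (forms 1) -> sigma Q (x \otimes y) = y \otimes x).

Definition pseudo_riemannian (Q : quasi_tame)
    (g : {linear tensor (forms 1) (forms 1) -> regbim A}) : Prop :=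
  [/\ forall u, g (sigma Q u) = g u,
      linear (metric_map g) &
      bijective (metric_map g)].

Definition bilinear_metric
    (g : {linear tensor (forms 1) (forms 1) -> regbim A}) : Prop :=
  forall (a : A) u, g (a *:l u) = a *:l g u.

End Forms.

Definition derivation (K : fieldType) (A : algType K) (D : {linear A -> A}) :
    Prop :=
  forall a b, D (a * b) = D a * b + a * D b.

HB.mixin Record isCStarAlgebra (R : realType) A of GRing.Algebra R[i] A := {
  cnorm : A -> R;
  star : A -> A;
  cnorm_eq0 : forall x, cnorm x = 0 -> x = 0;
  cnormD : forall x y, cnorm (x + y) <= cnorm x + cnorm y;
  (* `|c| is the modulus of c seen in R[i]. *)
  cnormZ : forall (c : R[i]) x, cnorm (c *: x) = complex.Re `|c| * cnorm x;
  cnormM : forall x y, cnorm (x * y) <= cnorm x * cnorm y;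
  cnorm_complete : forall u : nat -> A,
    (forall eps : R, 0 < eps -> exists N : nat, forall m n : nat,
       (N <= m)%N -> (N <= n)%N -> cnorm (u m - u n) < eps) ->
    exists l : A, cnorm (u n - l) @[n --> \oo] --> (0 : R);
  starD : {morph star : x y / x + y};
  starZ : forall (c : R[i]) x, star (c *: x) = Num.conj c *: star x;
  starM : forall x y, star (x * y) = star y * star x;
  starK : involutive star;
  cstar_identity : forall x, cnorm (star x * x) = cnorm x ^+ 2
}.

#[short(type="cstarAlgType")]
HB.structure Definition CStarAlgebra (R : realType) :=
  {A of isCStarAlgebra R A & GRing.Algebra R[i] A}.

Section Generated.
Context (R : realType) (A : cstarAlgType R) (n : nat) (S : 'I_n -> A).

(* For 0 < n the condition B 1 is redundant when the S i are isometries:      *)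
(* 1 = star (S i) * S i.                                                      *)
Definition star_subalgebra (B : set A) : Prop :=
  [/\ B 1,
      forall (c : R[i]) x y, B x -> B y -> B (c *: x + y),
      forall x y, B x -> B y -> B (x * y) &
      forall x, B x -> B (star x)].

Definition norm_closed (B : set A) : Prop :=
  forall (u : nat -> A) (l : A), (forall k, B (u k)) ->
    cnorm (u k - l) @[k --> \oo] --> (0 : R) -> B l.

Definition generates_cstar : Prop :=
  forall B : set A, star_subalgebra B -> norm_closed B ->
    (forall i, B (S i)) -> forall x, B x.

Definition star_span : {pred A} :=
  fun x => `[< forall B : set A, star_subalgebra B ->
                 (forall i, B (S i)) -> B x >].

Fact star_span_closed : subalg_closed star_span.
Proof.
split=> [|c x y /asboolP hx /asboolP hy|x y /asboolP hx /asboolP hy];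
  apply/asboolP=> B hB BS; have [B1 BZ BM _] := hB => //.
  by apply: BZ; [apply: hx | apply: hy].
by apply: BM; [apply: hx | apply: hy].
Qed.

HB.instance Definition _ :=
  GRing.isSubalgClosed.Build R[i] A star_span star_span_closed.

Fact star_span_star x : x \in star_span -> star x \in star_span.
Proof.
move=> /asboolP hx; apply/asboolP=> B hB BS.
by have [_ _ _ Bstar] := hB; apply: Bstar; exact: hx.
Qed.

Fact star_span_gen i : S i \in star_span.
Proof. by apply/asboolP=> B _; apply. Qed.

Definition gen_alg : Type := {x : A | x \in star_span}.
HB.instance Definition _ := SubChoice.on gen_alg.
HB.instance Definition _ := [SubChoice_isSubAlgebra of gen_alg by <:].

Definition gen_star (x : gen_alg) : gen_alg :=
  Sub (star (val x)) (star_span_star (valP x)).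

Definition gen (i : 'I_n) : gen_alg := Sub (S i) (star_span_gen i).

End Generated.

(* Main.v *)
(* The calculus is A \otimes Lambda(K^n) with d a = sum_i e_i D_i a, extended by
   d e_i = 0: it is a differential because the D_i are commuting derivations,
   and they commute because they do so on the generators S_j, S_j^*.  Since
   S_i^* D_j(S_i) = delta_ij, we have e_i = S_i^* dS_i, so that degree 0
   generates.  On a bimodule with a central basis (e_i), tame calculi come from
   the flip e_i \otimes e_j |-> e_j \otimes e_i, and P_sym = (1 + flip) / 2. *)
Require Import Defs.
From HB Require Import structures.
From mathcomp Require Import all_boot all_order all_algebra.
From mathcomp Require Import complex freeg.
From mathcomp Require Import all_classical all_reals topology normedtype.
From mathcomp Require Import finset.

Set Implicit Arguments.
Unset Strict Implicit.
Unset Printing Implicit Defensive.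

Import Order.TTheory GRing.Theory Num.Theory.

Local Open Scope ring_scope.

(** * Modules with a finite basis *)

(** Over a noncommutative [A] the rule [x \otimes y |-> y \otimes x] does not in general respect the
    tensor relations, so the flip, and with it P_sym, is prescribed on a basis; centrality of that
    basis makes these right linear maps bimodule maps. The product of one-forms is split by
    antisymmetrisation. The identity 1 - P_sym = split o wedge, with wedge o P_sym = 0 and wedge o
    split = 1, yields the idempotence, the range and the kernel of P_sym at once. The number 2 is
    assumed invertible in the base field: halves enter P_sym, and d d x = 0 is reached by showing
    that d d x is its own opposite. The calculus is built over such a field from commuting
    derivations D_i and elements S_i, T_i with T_i D_j(S_i) = delta_ij; the algebra of the theorem
    supplies them with T_i = S_i^* . *)

Section Basis.
Context (R : pzRingType) (I : finType) (M : lmodType R) (b : I -> M).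
Context (b_basis : is_basis b).

Definition bcoord (x : M) : I -> R := sval (cid (b_basis.1 x)).

Lemma bcoordE x : x = \sum_i bcoord x i *: b i.
Proof. exact: svalP (cid (b_basis.1 x)). Qed.

Lemma bcoord_uniq (c : I -> R) i : bcoord (\sum_i c i *: b i) i = c i.
Proof.
apply/eqP; rewrite -subr_eq0; apply/eqP; move: i.
apply: b_basis.2; under eq_bigr do rewrite scalerBl.
by rewrite sumrB -bcoordE subrr.
Qed.

Lemma bcoord_lin a x y i :
  bcoord (a *: x + y) i = a * bcoord x i + bcoord y i.
Proof.
have -> : a *: x + y = \sum_j (a * bcoord x j + bcoord y j) *: b j.
  under eq_bigr do rewrite scalerDl -scalerA.
  by rewrite big_split -scaler_sumr -!bcoordE.
exact: bcoord_uniq.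
Qed.

Lemma bcoordD x y i : bcoord (x + y) i = bcoord x i + bcoord y i.
Proof. by have := bcoord_lin 1 x y i; rewrite scale1r mul1r. Qed.

Lemma bcoordZ a x i : bcoord (a *: x) i = a * bcoord x i.
Proof.
have -> : a *: x = \sum_i (a * bcoord x i) *: b i.
  by under eq_bigr do rewrite -scalerA; rewrite -scaler_sumr -bcoordE.
exact: bcoord_uniq.
Qed.

Lemma sum_delta_scale i : \sum_j (i == j)%:R *: b j = b i.
Proof.
rewrite (bigD1 i) //= eqxx scale1r big1 ?addr0 // => j /negPf ji.
by rewrite eq_sym ji scale0r.
Qed.

Lemma bcoord_basis i j : bcoord (b i) j = (i == j)%:R.
Proof. by rewrite -[b i in LHS]sum_delta_scale bcoord_uniq. Qed.

Section Extension.
Context (P : lmodType R) (f : I -> P).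

Definition blin (x : M) : P := \sum_i bcoord x i *: f i.

Fact blin_linear : linear blin.
Proof.
move=> a x y; rewrite scaler_sumr -big_split; apply: eq_bigr => i _.
by rewrite bcoord_lin scalerDl scalerA.
Qed.

HB.instance Definition _ := GRing.isLinear.Build R M P _ blin blin_linear.

Lemma blin_basis i : blin (b i) = f i.
Proof.
rewrite /blin (bigD1 i) //= bcoord_basis eqxx scale1r big1 ?addr0 // => j ji.
by rewrite bcoord_basis eq_sym (negPf ji) scale0r.
Qed.

End Extension.

Lemma basis_ext (P : lmodType R) (f g : {linear M -> P}) :
  (forall i, f (b i) = g (b i)) -> forall x, f x = g x.
Proof.
move=> fg x; rewrite (bcoordE x) !linear_sum; apply: eq_bigr => i _.
by rewrite !linearZ /= fg.
Qed.

(** Choose preimages of the images of the basis vectors and extend linearly. *)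
Lemma basis_projective : projective M.
Proof.
move=> N P p f p_surj; have [g pg] := choice (fun i => p_surj (f (b i))).
exists (blin g).
have := @basis_ext P (p \o blin g) f; apply=> i.
by rewrite /= blin_basis pg.
Qed.

End Basis.

Lemma basis_finitely_generated (R : pzRingType) n (M : lmodType R)
  (b : 'I_n -> M) : is_basis b -> finitely_generated M.
Proof.
by move=> [b_gen _]; exists n, b => x; have [c ->] := b_gen x; exists c.
Qed.

(** * Bimodules with a central basis *)

Section CentralBasis.
Context (A : nzRingType) (I : finType) (M : bimodType A A) (e : I -> M).
Context (e_basis : is_basis e) (e_central : forall i, e i \in @central A M).

Notation coord := (bcoord e_basis).

Lemma lact_sum (a : A) (J : finType) (F : J -> M) :
  a *:l (\sum_j F j) = \sum_j a *:l F j.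
Proof.
by apply: (big_morph (lact a)) => [x y|]; [exact: lactDr|exact: lact0r].
Qed.

Lemma lact_basis a i : a *:l e i = e i *:r a.
Proof. by have /asboolP := e_central i. Qed.

(** Centrality gives a e_j c = e_j (a c), so the left action multiplies coordinates on the left.
    Coordinates live in [A^c]; the products are read in [A]. *)
Lemma coord_lact (a : A) (x : M) i :
  coord (a *:l x) i = a * (coord x i : A) :> A.
Proof.
have -> : a *:l x = \sum_j (a * (coord x j : A) : A^c) *: e j.
  rewrite {1}(bcoordE e_basis x) lact_sum; apply: eq_bigr => j _.
  by rewrite lact_ract lact_basis -ractM.
exact: (bcoord_uniq e_basis (fun j => a * (coord x j : A) : A^c)).
Qed.

Lemma coord_ract (x : M) (a : A) i :
  coord (x *:r a) i = (coord x i : A) * a :> A.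
Proof. exact: (bcoordZ e_basis (a : A^c) x i). Qed.

(** Compare the coordinates of a x and of x a. *)
Lemma central_coord (x : M) i :
  x \in @central A M -> (coord x i : A) \in @Defs.center A.
Proof.
by move=> /asboolP xC; apply/asboolP => a; rewrite -coord_lact xC coord_ract.
Qed.

(** On e_i c both sides are f(e_i) a c, since a can be moved past e_i in [M] and past f(e_i) in [P].
    This turns every right linear map considered below into a bimodule map. *)
Lemma central_linear (P : bimodType A A) (f : {linear M -> P}) :
  (forall i, f (e i) \in @central A P) -> forall a x, f (a *:l x) = a *:l f x.
Proof.
move=> fC a x; rewrite (bcoordE e_basis x) lact_sum !linear_sum /=.
have -> : a *:l (\sum_i f (coord x i *: e i)) =
    \sum_i a *:l f (coord x i *: e i).
  by apply: (big_morph (lact a)) => [y z|]; [exact: lactDr|exact: lact0r].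
apply: eq_bigr => i _; rewrite lact_ract lact_basis -ractM !linearZ /=.
by have /asboolP fCi := fC i; rewrite lact_ract fCi -ractM.
Qed.

End CentralBasis.

(** * Tensor products of bimodules with central bases *)

Section TensorSums.
Context (R B : pzRingType) (M : lmodType R^c) (N : bimodType R B).

Lemma tens_suml (I : finType) (F : I -> M) (y : N) :
  (\sum_i F i) \otimes y = \sum_i F i \otimes y.
Proof.
apply: (big_morph (fun x => x \otimes y)) => [x x'|]; first exact: tensDl.
by apply: (addrI (0 \otimes y)); rewrite -tensDl !addr0.
Qed.

Lemma tens_sumr (I : finType) (x : M) (F : I -> N) :
  x \otimes (\sum_i F i) = \sum_i x \otimes F i.
Proof.
apply: (big_morph (tens x)) => [y y'|]; first exact: tensDr.
by apply: (addrI (x \otimes 0)); rewrite -tensDr !addr0.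
Qed.

End TensorSums.

Section TensorBasis.
Context (A : nzRingType) (I J : finType) (M N : bimodType A A).
Context (e : I -> M) (f : J -> N).
Context (e_basis : is_basis e) (f_basis : is_basis f).
Context (f_central : forall j, f j \in @central A N).

Notation ecoord := (bcoord e_basis).
Notation fcoord := (bcoord f_basis).

Definition tensor_basis (ij : I * J) : tensor M N := e ij.1 \otimes f ij.2.

(** The functional dual to e_i \otimes f_j. It is balanced because f_j is central: in both x r
    \otimes y and x \otimes r y the scalar r ends up between the two coordinates. *)
Definition tensor_coord (i : I) (j : J) : tensor M N -> regbim A :=
  tlift (fun x y => (ecoord x i : A) * (fcoord y j : A) : A).

Fact tensor_coord_balanced i j :
  balanced (fun x y => ((ecoord x i : A) * (fcoord y j : A) : A) : regbim A).
Proof.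
split=> [x x' y|x y y'|x r y].
- by rewrite bcoordD; exact: (@mulrDl A).
- by rewrite bcoordD; exact: (@mulrDr A).
- by rewrite (coord_lact f_basis f_central) coord_ract mulrA.
Qed.

Lemma tensor_coord_tens i j x y :
  tensor_coord i j (x \otimes y) = (ecoord x i : A) * (fcoord y j : A) :> A.
Proof. exact: tlift_tens (tensor_coord_balanced i j) x y. Qed.

Fact tensor_coord_linear i j : linear (tensor_coord i j).
Proof.
apply: tlift_linear (tensor_coord_balanced i j) _ => x y b.
by rewrite coord_ract mulrA.
Qed.

HB.instance Definition _ i j := GRing.isLinear.Build A^c
  (tensor M N) (regbim A) _ (tensor_coord i j) (tensor_coord_linear i j).

Lemma tens_expand x y : x \otimes y = \sum_i \sum_j
  tensor_basis (i, j) *:r ((ecoord x i : A) * (fcoord y j : A)).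
Proof.
rewrite {1}(bcoordE e_basis x) tens_suml; apply: eq_bigr => i _.
rewrite tensM {1}(bcoordE f_basis y) lact_sum tens_sumr.
apply: eq_bigr => j _.
by rewrite lact_ract (lact_basis f_central) -ractM -tens_ract.
Qed.

(** Independence cannot be read off representatives in the quotient of a free group; it is detected
    by the functionals [tensor_coord], which also provide the coefficients for generation. *)
Lemma tensor_basisP : is_basis tensor_basis.
Proof.
split=> [u|c c0 [i j]].
  exists (fun ij => tensor_coord ij.1 ij.2 u : A^c); move: u.
  apply: tensor_ind => [|u v {1}-> {1}->|x y].
  - by rewrite big1 // => ij _; rewrite linear0 scale0r.
  - by rewrite -sumrB; apply: eq_bigr => ij _; rewrite linearB scalerBl.
  rewrite [LHS]tens_expand pair_bigA; apply: eq_bigr => -[i j] _.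
  by congr (_ *: _); exact: (esym (tensor_coord_tens i j x y)).
have : tensor_coord i j (\sum_ij c ij *: tensor_basis ij) = 0.
  by rewrite c0 linear0.
rewrite linear_sum (bigD1 (i, j)) //= linearZ /= tensor_coord_tens.
rewrite !bcoord_basis !eqxx mulr1.
rewrite big1 => [|[k l] /= kl].
  by rewrite addr0 => <-; rewrite -[RHS]/((1 : A) * (c (i, j) : A)) mul1r.
rewrite linearZ /= tensor_coord_tens !bcoord_basis.
have [ki|] := eqVneq k i; last by rewrite mul0r scaler0.
have [lj|] := eqVneq l j; last by rewrite mulr0 scaler0.
by rewrite ki lj eqxx in kl.
Qed.

End TensorBasis.

Arguments tensor_basis : simpl never.

Lemma tensor_basis_central (A : nzRingType) (I J : finType)
  (M N : bimodType A A) (e : I -> M) (f : J -> N)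
  (e_central : forall i, e i \in @central A M)
  (f_central : forall j, f j \in @central A N) ij :
  tensor_basis e f ij \in @central A (tensor M N).
Proof.
apply/asboolP => a; rewrite lact_tens (lact_basis e_central) tensM.
by rewrite (lact_basis f_central) -tens_ract.
Qed.

(** * The first tameness condition *)

Section CentralMul.
Context (A : nzRingType) (I : finType) (M : bimodType A A) (e : I -> M).
Context (e_basis : is_basis e) (e_central : forall i, e i \in @central A M).

Notation coord := (bcoord e_basis).

Definition central_basis (i : I) : centralSub M := Sub (e i) (e_central i).

Definition central_mul_inv (x : M) : tensor (centralSub M) (center_bim A) :=
  \sum_i central_basis i \otimes (coord x i : center_bim A).

(** A central z is a sum of e_i c_i with c_i in the center of [A], so each c_i may cross the tensor
    sign over [centerRing A]: z \otimes a is the sum of e_i \otimes c_i a, which is the value of the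
    inverse at z a. *)
Lemma central_mul_bij : bijective (@central_mul A M).
Proof.
exists central_mul_inv => [|x]; last first.
  rewrite /central_mul_inv linear_sum {2}(bcoordE e_basis x).
  by apply: eq_bigr => i _; rewrite /= central_mul_tens.
have invB : {morph central_mul_inv : x y / x - y}.
  move=> x y; rewrite /central_mul_inv -sumrB; apply: eq_bigr => i _.
  apply: (addIr (central_basis i \otimes (coord y i : center_bim A))).
  by rewrite subrK -tensDr -bcoordD subrK.
apply: tensor_ind => [|u v Pu Pv|z a].
- by rewrite linear0 -[X in central_mul_inv X](subrr 0) invB subrr.
- by rewrite linearB invB Pu Pv.
rewrite central_mul_tens /central_mul_inv.
have zC i := central_coord e_basis e_central i (valP z).
pose c i : centerRing A := exist _ (coord (val z) i : A) (zC i).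
have zE : z = \sum_i central_basis i *:r c i.
  apply: val_inj; rewrite raddf_sum /=; exact: bcoordE.
rewrite [in RHS]zE tens_suml; apply: eq_bigr => i _; rewrite tensM.
by congr (_ \otimes _); exact: (coord_ract e_basis (val z) (a : A) i).
Qed.

End CentralMul.

(** * The flip and the metric on a bimodule with a central basis *)

Section Swap.
Context (A : nzRingType) (I : finType) (M : bimodType A A) (e : I -> M).
Context (e_basis : is_basis e) (e_central : forall i, e i \in @central A M).

Notation coord := (bcoord e_basis).
Notation ee := (tensor_basis e e).
Notation ee_basis := (tensor_basisP e_basis e_basis e_central).

Definition swap : tensor M M -> tensor M M :=
  blin ee_basis (fun ij => ee (ij.2, ij.1)).
HB.instance Definition _ := GRing.isLinear.Build A^c
  (tensor M M) (tensor M M) _ swap (blin_linear _ _).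

Lemma swap_basis ij : swap (ee ij) = ee (ij.2, ij.1).
Proof. exact: blin_basis. Qed.

Lemma swap_lact a u : swap (a *:l u) = a *:l swap u.
Proof.
move: a u; apply: (central_linear ee_basis) => ij.
  exact: tensor_basis_central.
by rewrite /= swap_basis; exact: tensor_basis_central.
Qed.

(** The coefficients of the two sides on e_j \otimes e_i are x_i y_j and y_j x_i, and x_i lies in
    the center of [A]. *)
Lemma swap_central x y : x \in @central A M -> y \in @central A M ->
  swap (x \otimes y) = y \otimes x.
Proof.
move=> xC yC.
rewrite (tens_expand e_basis e_basis e_central).
rewrite (tens_expand e_basis e_basis e_central) exchange_big linear_sum.
apply: eq_bigr => j _; rewrite linear_sum; apply: eq_bigr => i _.
rewrite linearZ /= swap_basis; congr (_ *: _).
by have /asboolP := central_coord e_basis e_central i xC; apply.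
Qed.

Lemma alternating_swap (P : lmodType A^c) (w : {linear tensor M M -> P}) :
  (forall i j, w (e j \otimes e i) = - w (e i \otimes e j)) ->
  forall u, w (swap u) = - w u.
Proof.
move=> w_alt u; apply/eqP; rewrite -addr_eq0 -linearD; apply/eqP.
rewrite (bcoordE ee_basis u) linear_sum -big_split linear_sum.
rewrite big1 //= => -[i j] _.
rewrite [swap _]linearZ -scalerDr linearZ /= swap_basis linearD /=.
by rewrite [X in X + _]w_alt addNr scaler0.
Qed.

Definition dot : tensor M M -> regbim A :=
  @blin _ _ _ _ ee_basis (regbim A) (fun ij => (ij.1 == ij.2)%:R : A).
HB.instance Definition _ := GRing.isLinear.Build A^c
  (tensor M M) (regbim A) _ dot (blin_linear _ _).

Lemma dot_basis i j : dot (e i \otimes e j) = ((i == j)%:R : A) :> A.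
Proof. exact: (@blin_basis _ _ _ _ ee_basis (regbim A)
  (fun ij => (ij.1 == ij.2)%:R : A) (i, j)). Qed.

Lemma dot_swap u : dot (swap u) = dot u.
Proof.
apply: (@basis_ext _ _ _ _ ee_basis _ (dot \o swap) dot) => -[i j].
by rewrite /= swap_basis !dot_basis eq_sym.
Qed.

(** The values 0 and 1 on the central basis commute with [A], so right linearity implies left
    linearity. *)
Lemma dot_lact (a : A) u : dot (a *:l u) = a *:l dot u.
Proof.
move: a u; apply: (central_linear ee_basis) => ij.
  exact: tensor_basis_central.
apply/asboolP => a; rewrite /= /tensor_basis dot_basis.
by rewrite -[LHS]/(a * _%:R) -[RHS]/((_%:R : A) * a) -commr_nat.
Qed.

(** The right action on the dual precomposes with the left action on [M], which matches x a \otimes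
    z = x \otimes a z. *)
Lemma dot_map_linear : linear (metric_map dot).
Proof.
move=> a x y; apply/val_inj/funext => z.
rewrite -[RHS]/(dot (x \otimes ((a : A) *:l z)) + dot (y \otimes z)) /=.
by rewrite tensDl linearD -[a *: x]/(x *:r a) tensM.
Qed.

Lemma dot_tens x y :
  dot (x \otimes y) = \sum_i (coord x i : A) * (coord y i : A) :> A.
Proof.
rewrite (tens_expand e_basis e_basis e_central) linear_sum.
apply: eq_bigr => i _; rewrite linear_sum (bigD1 i) //= linearZ /= dot_basis.
rewrite eqxx big1 => [|j ji]; last first.
  by rewrite linearZ /= dot_basis eq_sym (negPf ji) scaler0.
by rewrite addr0; exact: (@mul1r A).
Qed.

(* The inverse of V_g sends f to \sum_i e_i f(e_i). *)
Lemma dot_map_bij : bijective (metric_map dot).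
Proof.
have dot_coord x i : dot (x \otimes e i) = coord x i :> A.
  rewrite dot_tens (bigD1 i) //= bcoord_basis eqxx mulr1 big1 ?addr0 // => j ji.
  by rewrite bcoord_basis eq_sym (negPf ji) mulr0.
exists (fun f : dual M => \sum_i e i *:r (val f (e i) : A)) => [x|f].
  rewrite [RHS](bcoordE e_basis); apply: eq_bigr => i _; congr (_ *: _).
  exact: dot_coord.
have /asboolP f_lin := valP f.
pose F : {linear M -> regbim A} :=
  HB.pack (val f) (GRing.isLinear.Build A^c M (regbim A) _ (val f) f_lin).
apply/val_inj/funext => y /=; rewrite [RHS](_ : _ = F y) // dot_tens.
rewrite [in RHS](bcoordE e_basis y) linear_sum; apply: eq_bigr => i _.
by rewrite linearZ /= (bcoord_uniq e_basis (fun i => val f (e i) : A^c)).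
Qed.

End Swap.

(** * The symmetrising projection and the splitting of the product *)

Section SymProj.
Context (A : nzRingType) (h : A) (h2 : h + h = 1).

(** The relation h + h = 1 alone forces h to be central: h a = h (a h + a h) = (h a + h a) h = a
    h. *)
Lemma half_comm a : h * a = a * h.
Proof.
have ahh : a = a * h + a * h by rewrite -mulrDr h2 mulr1.
have hha : a = h * a + h * a by rewrite -mulrDl h2 mul1r.
by rewrite {1}ahh mulrDr !mulrA -mulrDl -hha.
Qed.

Lemma ract_half (M : lmodType A^c) (x : M) : x *:r h + x *:r h = x.
Proof. by rewrite -(scalerDl x) -[RHS](scale1r x); congr (_ *: _). Qed.

Context (n : nat) (M P : bimodType A A) (e : 'I_n -> M).
Context (e_basis : is_basis e) (e_central : forall i, e i \in @central A M).

Notation ee := (tensor_basis e e).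
Notation ee_basis := (tensor_basisP e_basis e_basis e_central).
Notation tswap := (swap e_basis e_central).

(** The half is an element of [A] acting on the right, since the bimodules here carry no scalars
    from a base field. *)
Definition sym_proj (u : tensor M M) : tensor M M := (u + tswap u) *:r h.

Fact sym_proj_linear : linear sym_proj.
Proof.
move=> a u v; rewrite /sym_proj linearP addrACA -scalerDr [LHS]scalerDr.
rewrite !scalerA.
by congr (_ *: _ + _); exact/esym/(half_comm (a : A)).
Qed.

HB.instance Definition _ := GRing.isLinear.Build A^c
  (tensor M M) (tensor M M) _ sym_proj sym_proj_linear.

Definition sym_proj_lin : {linear tensor M M -> tensor M M} := sym_proj.

Lemma sym_proj_lact a u : sym_proj (a *:l u) = a *:l sym_proj u.
Proof. by rewrite /sym_proj swap_lact -lactDr lact_ract. Qed.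

Lemma sym_proj_reflection u : sym_proj u *+ 2 - u = tswap u.
Proof. by rewrite mulr2n ract_half addrC addKr. Qed.

Context (w : {linear tensor M M -> P}).
Context (w_swap : forall u, w (tswap u) = - w u).

Definition wedge_basis (pq : {pq : 'I_n * 'I_n | (pq.1 < pq.2)%N}) : P :=
  w (e (val pq).1 \otimes e (val pq).2).

Context (w_basis : is_basis wedge_basis).

(** Since [w] is alternating, the two terms have the same image under [w], and [h] normalises their
    sum so that this is a section of [w]. *)
Definition antisym_split : P -> tensor M M :=
  blin w_basis (fun pq => (ee (val pq) - ee ((val pq).2, (val pq).1)) *:r h).
HB.instance Definition _ := GRing.isLinear.Build A^c
  P (tensor M M) _ antisym_split (blin_linear _ _).

Lemma antisym_split_lt (p q : 'I_n) : (p < q)%N ->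
  antisym_split (w (ee (p, q))) = (ee (p, q) - ee (q, p)) *:r h.
Proof.
move=> pq; exact: (blin_basis w_basis _
  (exist (fun x : 'I_n * 'I_n => is_true (x.1 < x.2)%N) (p, q) pq)).
Qed.

(* Since 1 - P_sym factors through w, the kernel of w is the range of P_sym and
   the range of the splitting is the kernel of P_sym. *)
Lemma antisym_splitE u : antisym_split (w u) = u - sym_proj u.
Proof.
apply: (@basis_ext _ _ _ _ ee_basis _ (antisym_split \o w)
  (idfun \- sym_proj)) => -[i j].
rewrite /= /sym_proj swap_basis /= -{2}(ract_half (ee (i, j))) scalerDr.
rewrite opprD addrACA subrr add0r -scalerBr.
have [ij|ji|/val_inj ->] := ltngtP i j; first exact: antisym_split_lt.
  rewrite -[ee (i, j)](swap_basis e_basis e_central (j, i)) w_swap linearN.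
  by rewrite /= antisym_split_lt // swap_basis -scalerN opprB.
(* On the diagonal the flip is the identity, so the image under [w] is its own opposite, hence 0 by
   halving. *)
have wjj : w (ee (j, j)) = - w (ee (j, j)) by rewrite -w_swap swap_basis.
rewrite subrr scaler0 -(ract_half (w _)) {2}wjj scalerN subrr.
exact: linear0.
Qed.

Lemma w_sym_proj u : w (sym_proj u) = 0.
Proof. by rewrite linearZ /= linearD w_swap subrr scaler0. Qed.

Lemma antisym_splitK : cancel antisym_split w.
Proof.
apply: (@basis_ext _ _ _ _ w_basis _ (w \o antisym_split) idfun) => -[[i j] ij].
have -> : wedge_basis (exist _ (i, j) ij) = w (ee (i, j)) by [].
rewrite /= antisym_split_lt // linearZ /= linearB /=.
rewrite -[ee (j, i)](swap_basis e_basis e_central (i, j)) w_swap opprK.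
by rewrite scalerDr ract_half.
Qed.

(** As [w] undoes the splitting s, [antisym_splitE] at s y reads s y = s y - P_sym (s y). *)
Lemma sym_proj_split y : sym_proj (antisym_split y) = 0.
Proof.
have := antisym_splitE (antisym_split y).
rewrite antisym_splitK => /(congr1 (fun v => antisym_split y - v)).
by rewrite subrr opprB addrC subrK.
Qed.

Lemma sym_proj_range : range sym_proj = [set u | w u = 0]%classic.
Proof.
apply/seteqP; split => [_ [u _ <-]|u /= wu0]; first exact: w_sym_proj.
have := antisym_splitE u; rewrite wu0 linear0 => /esym/eqP.
by rewrite subr_eq0 => /eqP ->; exists u.
Qed.

(** Apply 1 - P_sym = split o w to P_sym u, on which [w] vanishes. *)
Lemma sym_proj_idem u : sym_proj (sym_proj u) = sym_proj u.
Proof.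
have := antisym_splitE (sym_proj u); rewrite w_sym_proj linear0 => /esym/eqP.
by rewrite subr_eq0 => /eqP/esym.
Qed.

Lemma sym_proj_ker : [set u | sym_proj u = 0]%classic = range antisym_split.
Proof.
apply/seteqP; split => [u /= u0|_ [y _ <-]]; last exact: sym_proj_split.
by exists (w u); rewrite // antisym_splitE u0 subr0.
Qed.

End SymProj.

(** * The exterior algebra with coefficients in an algebra *)

Section Inversions.
Context (n : nat).
Implicit Types t u v : {set 'I_n}.

(* (-1) ^+ inversions t u is the sign in e_t e_u = +/- e_(t :|: u). *)
Definition inversions t u : nat := \sum_(a in t) \sum_(b in u) (b < a).

Lemma disjoint_setUl t u v :
  [disjoint t :|: u & v] = [disjoint t & v] && [disjoint u & v].
Proof. by rewrite !disjoints_subset subUset. Qed.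

Lemma disjoint_setUr t u v :
  [disjoint t & u :|: v] = [disjoint t & u] && [disjoint t & v].
Proof. by rewrite ![[disjoint t & _]]disjoint_sym disjoint_setUl. Qed.

Lemma disjoint_set0l t : [disjoint set0 & t].
Proof. by rewrite disjoints_subset sub0set. Qed.

Lemma disjoint_set0r t : [disjoint t & set0].
Proof. by rewrite disjoint_sym disjoint_set0l. Qed.

Lemma sum_setU_disjoint t u (F : 'I_n -> nat) : [disjoint t & u] ->
  \sum_(a in t :|: u) F a = (\sum_(a in t) F a + \sum_(a in u) F a)%N.
Proof.
by move=> tu; rewrite -bigU //; apply: eq_bigl => a; rewrite in_setU.
Qed.

Lemma inversionsUl t u v : [disjoint t & u] ->
  inversions (t :|: u) v = (inversions t v + inversions u v)%N.
Proof. exact: sum_setU_disjoint. Qed.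

Lemma inversionsUr t u v : [disjoint u & v] ->
  inversions t (u :|: v) = (inversions t u + inversions t v)%N.
Proof.
move=> uv; rewrite /inversions -big_split; apply: eq_bigr => a _.
exact: sum_setU_disjoint.
Qed.

Lemma inversions0l u : inversions set0 u = 0.
Proof. by rewrite /inversions big_set0. Qed.

Lemma inversions0r t : inversions t set0 = 0.
Proof. by rewrite /inversions big1 // => a _; rewrite big_set0. Qed.

Lemma inversions1 i j : inversions [set i] [set j] = (j < i)%N.
Proof. by rewrite /inversions !big_set1. Qed.

(** By disjointness every pair in t x u has distinct entries, so it is counted by exactly one of the
    two terms. *)
Lemma inversions_swap t u : [disjoint t & u] ->
  (inversions t u + inversions u t)%N = (#|t| * #|u|)%N.
Proof.
move=> tu; rewrite {2}/inversions exchange_big /= -big_split /=.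
rewrite -[#|t|]sum1_card big_distrl; apply: eq_bigr => a ta /=.
rewrite mul1n -sum1_card -big_split; apply: eq_bigr => b ub /=.
case: ltngtP => // /val_inj ab.
by move: (disjointFr tu ta); rewrite -ab ub.
Qed.

End Inversions.

Section Exterior.
Context (K : fieldType) (A : algType K) (n : nat).
Implicit Types (s t u v : {set 'I_n}) (a b c : A).

(* An element of A \otimes Lambda(K^n), by its coordinates on the products
   e_(i_1) ... e_(i_k) for i_1 < ... < i_k. *)
Definition ext : Type := {ffun {set 'I_n} -> A}.
HB.instance Definition _ := GRing.Lmodule.on ext.

Implicit Types x y z : ext.

Definition mono t a : ext := [ffun s => if s == t then a else 0].

Lemma monoE t a s : mono t a s = if s == t then a else 0.
Proof. by rewrite ffunE. Qed.

Fact mono_linear t : linear (mono t).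
Proof.
move=> k a b; apply/ffunP => s; rewrite !ffunE.
by case: eqP => //; rewrite scaler0 addr0.
Qed.
HB.instance Definition _ t :=
  GRing.isLinear.Build K A ext _ (mono t) (mono_linear t).

Lemma ext_sum x : x = \sum_t mono t (x t).
Proof.
apply/ffunP => s; rewrite sum_ffunE (bigD1 s) //= monoE eqxx big1 ?addr0 //.
by move=> t ts; rewrite monoE eq_sym (negPf ts).
Qed.

(** The product of e_t a and e_u b: the e_i commute with coefficients, anticommute with each other
    and have square 0, so a common index gives 0. *)
Definition mono_mul t a u b : ext :=
  if [disjoint t & u] then mono (t :|: u) ((-1) ^+ inversions t u * (a * b))
  else 0.

Lemma mono_mulDl t u b : {morph (fun a => mono_mul t a u b) : a a' / a + a'}.
Proof.
move=> a a'; rewrite /mono_mul; case: ifP => _; last by rewrite addr0.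
by rewrite mulrDl mulrDr linearD.
Qed.

Lemma mono_mulDr t a u : {morph (mono_mul t a u) : b b' / b + b'}.
Proof.
move=> b b'; rewrite /mono_mul; case: ifP => _; last by rewrite addr0.
by rewrite !mulrDr linearD.
Qed.

Lemma mono_mul0l t u b : mono_mul t 0 u b = 0.
Proof. by rewrite /mono_mul mul0r mulr0 linear0 if_same. Qed.

Lemma mono_mul0r t a u : mono_mul t a u 0 = 0.
Proof. by rewrite /mono_mul !mulr0 linear0 if_same. Qed.

Lemma mono_mulZl t u b (k : K) a :
  mono_mul t (k *: a) u b = k *: mono_mul t a u b.
Proof.
rewrite /mono_mul; case: ifP => _; last by rewrite scaler0.
by rewrite -scalerAl -scalerAr linearZ.
Qed.

Lemma mono_mulZr t u b (k : K) a :
  mono_mul t a u (k *: b) = k *: mono_mul t a u b.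
Proof.
rewrite /mono_mul; case: ifP => _; last by rewrite scaler0.
by rewrite -!scalerAr linearZ.
Qed.

Definition emul x y : ext := \sum_t \sum_u mono_mul t (x t) u (y u).

Lemma emul_mono t a u b : emul (mono t a) (mono u b) = mono_mul t a u b.
Proof.
rewrite /emul (bigD1 t) //= [X in _ + X]big1 => [|t' tt']; last first.
  by rewrite big1 // => u' _; rewrite monoE (negPf tt') mono_mul0l.
rewrite addr0 (bigD1 u) //= [X in _ + X]big1 => [|u' uu']; last first.
  by rewrite [mono u b u']monoE (negPf uu') mono_mul0r.
by rewrite addr0 !monoE !eqxx.
Qed.

Lemma emulDl : left_distributive emul +%R.
Proof.
move=> x y z; rewrite /emul -big_split; apply: eq_bigr => t _.
by rewrite -big_split; apply: eq_bigr => u _; rewrite ffunE mono_mulDl.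
Qed.

Lemma emulDr : right_distributive emul +%R.
Proof.
move=> x y z; rewrite /emul -big_split; apply: eq_bigr => t _.
by rewrite -big_split; apply: eq_bigr => u _; rewrite ffunE mono_mulDr.
Qed.

Lemma emulZl (k : K) x y : k *: emul x y = emul (k *: x) y.
Proof.
rewrite /emul scaler_sumr; apply: eq_bigr => t _.
by rewrite scaler_sumr; apply: eq_bigr => u _; rewrite ffunE mono_mulZl.
Qed.

Lemma emulZr (k : K) x y : k *: emul x y = emul x (k *: y).
Proof.
rewrite /emul scaler_sumr; apply: eq_bigr => t _.
by rewrite scaler_sumr; apply: eq_bigr => u _; rewrite ffunE mono_mulZr.
Qed.

Let emul0l x : emul 0 x = 0.
Proof. by apply: (addrI (emul 0 x)); rewrite -emulDl !addr0. Qed.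
Let emul0r x : emul x 0 = 0.
Proof. by apply: (addrI (emul x 0)); rewrite -emulDr !addr0. Qed.

(** Both sides vanish unless t, u, v are pairwise disjoint; then additivity of [inversions] gives
    both the exponent inv(t,u) + inv(t,v) + inv(u,v). *)
Lemma mono_mulA t u v a b c :
  emul (mono t a) (mono_mul u b v c) = emul (mono_mul t a u b) (mono v c).
Proof.
rewrite {1 2}/mono_mul.
have [uv|uv] := boolP [disjoint u & v]; last first.
  rewrite emul0r; case: ifP => _; last by rewrite emul0l.
  by rewrite emul_mono /mono_mul disjoint_setUl (negPf uv) andbF.
case: ifP => tu; last first.
  by rewrite emul0l emul_mono /mono_mul disjoint_setUr tu.
rewrite !emul_mono /mono_mul disjoint_setUl disjoint_setUr uv tu andbT /=.
case: ifP => _ //; rewrite setUA; congr mono.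
have signC k (p q : A) : p * ((-1) ^+ k * q) = (-1) ^+ k * (p * q).
  by rewrite mulrA commr_sign -mulrA.
rewrite [a * _]signC -!mulrA !(mulrA (_ ^+ _) (_ ^+ _)) -!exprD.
by rewrite inversionsUl // inversionsUr // -addnA addnC.
Qed.

Fact emulA : associative emul.
Proof.
have suml (F : {set 'I_n} -> ext) y : emul (\sum_t F t) y = \sum_t emul (F t) y.
  by apply: (big_morph (emul^~ y)) => [x z|]; [exact: emulDl|exact: emul0l].
have sumr (F : {set 'I_n} -> ext) y : emul y (\sum_t F t) = \sum_t emul y (F t).
  by apply: (big_morph (emul y)) => [x z|]; [exact: emulDr|exact: emul0r].
move=> x y z; rewrite (ext_sum x) !suml; apply: eq_bigr => t _.
rewrite (ext_sum y) sumr !suml !sumr; apply: eq_bigr => u _.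
rewrite (ext_sum z) !sumr; apply: eq_bigr => v _.
by rewrite !emul_mono mono_mulA.
Qed.

Fact emul1l : left_id (mono set0 1) emul.
Proof.
move=> x; rewrite (ext_sum x).
rewrite (big_morph (emul _) (emulDr _) (emul0r _)); apply: eq_bigr => t _.
by rewrite emul_mono /mono_mul disjoint_set0l set0U inversions0l !mul1r.
Qed.

Fact emul1r : right_id (mono set0 1) emul.
Proof.
move=> x; rewrite (ext_sum x).
rewrite (big_morph (emul^~ _) (fun y z => emulDl y z _) (emul0l _)).
apply: eq_bigr => t _.
by rewrite emul_mono /mono_mul disjoint_set0r setU0 inversions0r mul1r mulr1.
Qed.

Fact mono0_1_neq0 : mono set0 1 != 0.
Proof.
apply/eqP => /ffunP/(_ set0); rewrite !ffunE eqxx => /eqP.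
by rewrite oner_eq0.
Qed.

HB.instance Definition _ := GRing.Zmodule_isNzRing.Build ext
  emulA emul1l emul1r emulDl emulDr mono0_1_neq0.

HB.instance Definition _ := GRing.Lmodule_isLalgebra.Build K ext emulZl.
HB.instance Definition _ := GRing.Lalgebra_isAlgebra.Build K ext emulZr.

Lemma mono_mulE t a u b : mono t a * mono u b = mono_mul t a u b.
Proof. exact: emul_mono. Qed.

End Exterior.

(** * Grading and differential on the exterior algebra *)

Section Homogeneous.
Context (K : fieldType) (A : algType K) (n : nat).
Implicit Types (s t u v : {set 'I_n}) (a b c : A).

Notation ext := (ext A n).
Implicit Types x y z : ext.

Definition homog k : {pred ext} :=
  fun x => [forall s : {set 'I_n}, (#|s| != k) ==> (x s == 0)].

Lemma homogP k x : reflect (forall s, #|s| != k -> x s = 0) (x \in homog k).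
Proof.
apply: (iffP forallP) => h s; first by move=> sk; apply/eqP/(implyP (h s)).
by apply/implyP => sk; apply/eqP/h.
Qed.

Fact homog_closed k : submod_closed (homog k).
Proof.
split=> [|c x y /homogP hx /homogP hy]; apply/homogP => s sk.
  by rewrite ffunE.
by rewrite !ffunE hx // hy // scaler0 addr0.
Qed.

HB.instance Definition _ k :=
  GRing.isSubmodClosed.Build K ext (homog k) (homog_closed k).

Lemma mono_homog k t a : #|t| = k -> mono t a \in homog k.
Proof.
move=> <-; apply/homogP => s st; rewrite monoE ifN //.
by apply: contraNneq st => ->.
Qed.

Lemma homog_sum k x : x \in homog k ->
  x = \sum_(t : {set 'I_n} | #|t| == k) mono t (x t).
Proof.
move=> /homogP hx; rewrite {1}(ext_sum x).
rewrite [LHS](bigID (fun t : {set 'I_n} => #|t| == k)) /=.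
by rewrite [X in _ + X]big1 ?addr0 // => t /hx ->; rewrite linear0.
Qed.

Lemma homogM i j x y :
  x \in homog i -> y \in homog j -> x * y \in homog (i + j)%N.
Proof.
move=> /homogP hx /homogP hy.
apply: rpred_sum => t _; apply: rpred_sum => u _.
have [<-|/hx ->] := eqVneq #|t| i; last by rewrite mono_mul0l rpred0.
have [<-|/hy ->] := eqVneq #|u| j; last by rewrite mono_mul0r rpred0.
rewrite /mono_mul; case: ifPn => [tu|_]; last exact: rpred0.
have /eqP <- : #|t :|: u| == (#|t| + #|u|)%N by rewrite (leq_card_setU t u).2.
exact: mono_homog.
Qed.

Definition eps (i : 'I_n) : ext := mono [set i] 1.

(** The inserted sign cancels the one that sorting i into s produces. This peels off one factor in
    the proof that degree 0 generates. *)
Lemma mono_setU1 i s a : i \notin s ->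
  mono (i |: s) a = eps i * mono s ((-1) ^+ inversions [set i] s * a).
Proof.
move=> si; rewrite mono_mulE /mono_mul disjoints1 si mul1r.
by rewrite signrMK.
Qed.

Lemma mul_mono0E x a s : (x * mono set0 a) s = x s * a.
Proof.
rewrite {1}(ext_sum x) mulr_suml sum_ffunE (bigD1 s) //= big1 => [|t ts].
  rewrite mono_mulE /mono_mul disjoint_set0r setU0 inversions0r monoE eqxx.
  by rewrite mul1r addr0.
rewrite mono_mulE /mono_mul disjoint_set0r setU0 monoE.
by rewrite eq_sym (negPf ts).
Qed.

Lemma mono0_mulE x a s : (mono set0 a * x) s = a * x s.
Proof.
rewrite {1}(ext_sum x) mulr_sumr sum_ffunE (bigD1 s) //= big1 => [|t ts].
  rewrite mono_mulE /mono_mul disjoint_set0l set0U inversions0l monoE eqxx.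
  by rewrite mul1r addr0.
rewrite mono_mulE /mono_mul disjoint_set0l set0U monoE.
by rewrite eq_sym (negPf ts).
Qed.

(** The sign on the left is in [K], as in the graded Leibniz rule; the one on the right is in [A],
    as in [mono_mul]. *)
Lemma scale_sign k a : (-1) ^+ k *: a = (-1) ^+ k * a.
Proof.
rewrite -signr_odd -[in RHS]signr_odd.
by case: odd; rewrite ?scaleN1r ?mulN1r ?scale1r ?mul1r.
Qed.

(** On e_t a with i not in t, the exponents of the two orders add up to the cardinal of t by
    [inversions_swap], so they differ by k modulo 2. If i is in t, both sides are 0. *)
Lemma eps_comm i k x : x \in homog k -> eps i * x = (-1) ^+ k *: (x * eps i).
Proof.
move=> /homog_sum ->; rewrite mulr_sumr mulr_suml scaler_sumr.
apply: eq_bigr => t /eqP <-; rewrite !mono_mulE /mono_mul.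
rewrite [[disjoint t & _]]disjoint_sym.
case: ifPn => it; last by rewrite scaler0.
rewrite -linearZ setUC mul1r mulr1 /= scale_sign mulrA -exprD.
have := inversions_swap it; rewrite cards1 mul1n => <-.
by rewrite -addnA addnn exprD -[(-1) ^+ _.*2]signr_odd odd_double mulr1.
Qed.

Lemma eps_homog i : eps i \in homog 1.
Proof. exact/mono_homog/cards1. Qed.

Lemma eps_anticomm i j : eps i * eps j = - (eps j * eps i).
Proof. by rewrite (eps_comm i (eps_homog j)) expr1 scaleN1r. Qed.

Context (D : 'I_n -> {linear A -> A}) (D_der : forall i, derivation (D i)).
Context (D_comm : forall i j a, D i (D j a) = D j (D i a)).

Definition ext_der i x : ext := [ffun s => D i (x s)].

Fact ext_der_linear i : linear (ext_der i).
Proof. by move=> c x y; apply/ffunP => s; rewrite !ffunE linearP. Qed.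

HB.instance Definition _ i :=
  GRing.isLinear.Build K ext ext _ (ext_der i) (ext_der_linear i).

Lemma ext_der_mono i t a : ext_der i (mono t a) = mono t (D i a).
Proof. by apply/ffunP => s; rewrite !ffunE; case: ifP; rewrite ?linear0. Qed.

Lemma der_sign i k a : D i ((-1) ^+ k * a) = (-1) ^+ k * D i a.
Proof. by rewrite -!scale_sign linearZ. Qed.

Lemma der1 i : D i 1 = 0.
Proof.
by apply: (addrI (D i 1)); rewrite -[in RHS](mulr1 1) D_der mulr1 mul1r addr0.
Qed.

Lemma ext_derM i x y : ext_der i (x * y) = ext_der i x * y + x * ext_der i y.
Proof.
rewrite (ext_sum x) mulr_suml !linear_sum !mulr_suml -big_split.
apply: eq_bigr => t _.
rewrite (ext_sum y) mulr_sumr !linear_sum !mulr_sumr -big_split.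
apply: eq_bigr => u _; rewrite /= !ext_der_mono !mono_mulE /mono_mul.
case: ifP => _; last by rewrite linear0 addr0.
by rewrite ext_der_mono der_sign D_der mulrDr linearD.
Qed.

Lemma ext_der_eps i j : ext_der i (eps j) = 0.
Proof. by rewrite ext_der_mono der1 linear0. Qed.

Lemma ext_der_homog i k x : x \in homog k -> ext_der i x \in homog k.
Proof.
by move=> /homogP hx; apply/homogP => s sk; rewrite ffunE hx // linear0.
Qed.

Definition ext_diff x : ext := \sum_i eps i * ext_der i x.

Fact ext_diff_linear : linear ext_diff.
Proof.
move=> c x y; rewrite scaler_sumr -big_split; apply: eq_bigr => i _.
by rewrite linearP mulrDr -scalerAr.
Qed.

HB.instance Definition _ :=
  GRing.isLinear.Build K ext ext _ ext_diff ext_diff_linear.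

Lemma ext_diff_homog k x : x \in homog k -> ext_diff x \in homog k.+1.
Proof.
move=> hx; apply: rpred_sum => i _; rewrite -add1n.
exact: homogM (eps_homog i) (ext_der_homog i hx).
Qed.

(** Each [ext_der i] is an ungraded derivation; the sign comes only from moving [eps i] past x. *)
Lemma ext_diffM k x y : x \in homog k ->
  ext_diff (x * y) = ext_diff x * y + (-1) ^+ k *: (x * ext_diff y).
Proof.
move=> hx; rewrite mulr_suml mulr_sumr scaler_sumr -big_split.
apply: eq_bigr => i _; rewrite /= ext_derM mulrDr !mulrA; congr (_ + _).
by rewrite (eps_comm i hx) -scalerAl.
Qed.

(** The products e_i e_j are antisymmetric in i, j and the iterated derivations symmetric, so
    exchanging the indices shows that the double sum is its own opposite. *)
Lemma ext_diff_diff (two : 2%:R != 0 :> K) x : ext_diff (ext_diff x) = 0.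
Proof.
have dd : ext_diff (ext_diff x) =
    \sum_i \sum_j eps i * eps j * ext_der i (ext_der j x).
  apply: eq_bigr => i _; rewrite linear_sum mulr_sumr; apply: eq_bigr => j _.
  by rewrite /= ext_derM ext_der_eps mul0r add0r mulrA.
have ddN : ext_diff (ext_diff x) = - ext_diff (ext_diff x).
  rewrite {1}dd exchange_big dd -sumrN; apply: eq_bigr => i _.
  rewrite -sumrN; apply: eq_bigr => j _; rewrite eps_anticomm mulNr.
  congr (- (_ * _)); apply/ffunP => s; rewrite !ffunE; exact: D_comm.
apply/eqP; move/eqP: ddN; rewrite -addr_eq0 -mulr2n -scaler_nat scaler_eq0.
by rewrite (negPf two).
Qed.

End Homogeneous.

(** * The calculus of a family of commuting derivations *)

Section Calculus.
Context (K : fieldType) (A : algType K) (n : nat).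

(** All degrees are subtypes of one algebra, so the laws of a [dga] reduce through [val] to
    identities in [ext]. *)
Definition ext_comp k : Type := {x : ext A n | x \in homog k}.
HB.instance Definition _ k := SubChoice.on (ext_comp k).
HB.instance Definition _ k := [SubChoice_isSubLmodule of ext_comp k by <:].

Fact comp_wedge_proof i j k (e : (i + j)%N = k) (x : ext_comp i)
  (y : ext_comp j) : val x * val y \in homog k.
Proof. by rewrite -e; apply: homogM (valP x) (valP y). Qed.

Definition comp_wedge i j k (e : (i + j)%N = k) (x : ext_comp i)
  (y : ext_comp j) : ext_comp k := Sub (val x * val y) (comp_wedge_proof e x y).

Fact comp_const_proof (a : A) : (mono set0 a : ext A n) \in homog 0.
Proof. exact/mono_homog/cards0. Qed.

Definition comp_const (a : A) : ext_comp 0 :=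
  Sub (mono set0 a) (comp_const_proof a).

Fact comp_const_linear : linear comp_const.
Proof. by move=> c a b; apply: val_inj; rewrite /= !linearP. Qed.

HB.instance Definition _ :=
  GRing.isLinear.Build K A (ext_comp 0) _ comp_const comp_const_linear.

Lemma comp_const_bij : bijective comp_const.
Proof.
exists (fun x : ext_comp 0 => (val x : ext A n) set0) => [a|x].
  by rewrite /= monoE eqxx.
apply: val_inj; apply/ffunP => s /=; rewrite monoE.
case: eqP => [->//|/eqP s0]; have /homogP -> // := valP x.
by rewrite cards_eq0.
Qed.

Context (D : 'I_n -> {linear A -> A}).

Fact comp_diff_proof k (x : ext_comp k) : ext_diff D (val x) \in homog k.+1.
Proof. exact: ext_diff_homog (valP x). Qed.

Definition comp_diff k (x : ext_comp k) : ext_comp k.+1 :=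
  Sub (ext_diff D (val x)) (comp_diff_proof x).

Fact comp_diff_linear k : linear (@comp_diff k).
Proof. by move=> c x y; apply: val_inj; rewrite /= !linearP. Qed.

HB.instance Definition _ k := GRing.isLinear.Build K
  (ext_comp k) (ext_comp k.+1) _ (@comp_diff k) (@comp_diff_linear k).

Context (D_der : forall i, derivation (D i)).
Context (D_comm : forall i j a, D i (D j a) = D j (D i a)).
Context (two : 2%:R != 0 :> K).

(** Kept transparent: components, product and differential of the calculus are later identified with
    those of [ext] by conversion. *)
Definition ext_dga : dga K.
Proof.
refine (@Dga K (fun k => ext_comp k) comp_wedge (comp_const 1)
  (fun k => @comp_diff k) _ _ _ _ _ _ _).
- move=> i j k e y c x x'; apply: val_inj => /=.
  by rewrite mulrDl scalerAl.
- move=> i j k e x c y y'; apply: val_inj => /=.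
  by rewrite mulrDr scalerAr.
- by move=> *; apply: val_inj; exact: mulrA.
- by move=> *; apply: val_inj; exact: mul1r.
- by move=> *; apply: val_inj; exact: mulr1.
- by move=> k x; apply: val_inj; exact: ext_diff_diff.
- by move=> i j k e e1 e2 x y; apply: val_inj; exact: ext_diffM (valP x).
Defined.

Context (S T : 'I_n -> A) (TS : forall i j, T i * D j (S i) = (i == j)%:R).

Lemma eps_diff i : mono set0 (T i) * ext_diff D (mono set0 (S i)) = eps A i.
Proof.
apply/ffunP => s; rewrite mono0_mulE sum_ffunE mulr_sumr (bigD1 i) //= big1.
  rewrite addr0 ext_der_mono mono_mulE /mono_mul disjoint_set0r.
  rewrite setU0 inversions0r !mul1r !monoE.
  by case: eqP => _; rewrite ?mulr0 // TS eqxx.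
move=> j ji; rewrite ext_der_mono mono_mulE /mono_mul disjoint_set0r.
rewrite inversions0r !mul1r monoE.
by case: eqP => _; rewrite ?mulr0 // TS eq_sym (negPf ji).
Qed.

(** By induction on the degree, [B] contains each e_s a: some e_i with i in s is peeled off and
    replaced by T_i dS_i. Every form is a sum of such monomials. *)
Lemma ext_dga_gen : generated_in_degree0 ext_dga.
Proof.
move=> B [_ B_lin B_mul B_diff] B_const.
have B_val k (x y : ext_comp k) : val x = val y -> B k x -> B k y.
  by move=> /val_inj ->.
have B_sum k (I : Type) (r : seq I) (P : pred I) (F : I -> ext_comp k) :
    (forall i, P i -> B k (F i)) -> B k (\sum_(i <- r | P i) F i).
  have [B0 BD] := B_lin k; move=> BF.
  by apply: big_ind => // x y Bx By; rewrite -[x]scale1r; exact: BD.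
have B_mono k : forall (s : {set 'I_n}) (sk : #|s| = k) (a : A)
      (h : mono s a \in homog k),
    B k (Sub (mono s a) h : ext_comp k).
  elim: k => [|k IHk] s sk a h; first exact: B_const.
  have [i si] : exists i, i \in s by apply/card_gt0P; rewrite sk.
  have si' : i \notin s :\ i by rewrite !inE eqxx.
  have sk' : #|s :\ i| = k by move: sk; rewrite (cardsD1 i) si => -[].
  have h' := mono_homog ((-1) ^+ inversions [set i] (s :\ i) * a) sk'.
  have := B_mul _ _ _ (erefl (1 + k)%N) _ _ (B_mul _ _ _ (erefl (0 + 1)%N) _ _
    (B_const (comp_const (T i)))
    (B_diff _ _ (B_const (comp_const (S i))))) (IHk _ sk' _ h').
  apply: B_val; rewrite /= eps_diff -mono_setU1 //.
  by rewrite setD1K.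
move=> k x.
(* The default 0 is taken only if the monomial is not of degree k, which never happens for the s of
   cardinal k summed over below. *)
pose F s : ext_comp k := insubd 0 (mono s ((val x : ext A n) s)).
apply: (B_val _ (\sum_(s : {set 'I_n} | #|s| == k) F s)).
  rewrite [RHS](homog_sum (valP x)) raddf_sum; apply: eq_bigr => s /eqP sk.
  by rewrite [LHS](_ : _ = val (F s)) // val_insubd mono_homog.
apply: B_sum => s /eqP sk; rewrite /F /insubd.
case: insubP => [y _ yE|]; last by rewrite mono_homog.
by have := valP y; rewrite yE => h; have := B_mono _ _ sk _ h; apply: B_val.
Qed.

Definition ext_calculus : calculus A.
Proof.
refine (@Calculus K A ext_dga comp_const comp_const_bij erefl _ ext_dga_gen).
move=> a b; apply: val_inj; apply/ffunP => s.
by rewrite /= mono0_mulE !monoE; case: eqP; rewrite ?mulr0.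
Defined.

End Calculus.

(** * Tameness and metric from a central, anticommuting basis of one-forms *)

Section FreeCalculus.
Context (K : fieldType) (A : algType K) (two : 2%:R != 0 :> K).
Context (Om : calculus A) (n : nat) (e : 'I_n -> forms Om 1).
Context (e_basis : is_basis e).
Context (e_central : forall i, e i \in @central A (forms Om 1)).
Context (e_alt : forall i j,
  wedge2 (e j \otimes e i) = - wedge2 (e i \otimes e j)).
Context (w_basis : is_basis (wedge_basis e (@wedge2 K A Om))).

Definition half : A := (2%:R^-1)%:A.

Lemma halfD : half + half = 1.
Proof.
rewrite -scalerDl.
have -> : 2%:R^-1 + 2%:R^-1 = 1 :> K.
  by rewrite -[RHS](mulfV two) mulr_natl mulr2n.
exact: scale1r.
Qed.

Let wedge_swap := alternating_swap e_basis e_central e_alt.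

Definition free_quasi_tame : quasi_tame Om :=
  @QuasiTame _ _ Om
    (basis_finitely_generated e_basis) (basis_projective e_basis)
    (antisym_split half w_basis)
    (antisym_splitK halfD wedge_swap w_basis)
    (sym_proj_lin halfD e_basis e_central)
    (sym_proj_idem halfD wedge_swap w_basis)
    (sym_proj_range halfD wedge_swap w_basis)
    (sym_proj_ker halfD wedge_swap w_basis)
    (sym_proj_lact half e_basis e_central).

Lemma free_sigmaE u : sigma free_quasi_tame u = swap e_basis e_central u.
Proof. exact: (sym_proj_reflection halfD). Qed.

Lemma free_tame : tame free_quasi_tame.
Proof.
split; first exact: (central_mul_bij e_basis e_central).
by move=> x y xC yC; rewrite free_sigmaE; exact: swap_central.
Qed.

Lemma dot_pseudo_riemannian :
  pseudo_riemannian free_quasi_tame (dot e_basis e_central).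
Proof.
split=> [u||]; first by rewrite free_sigmaE; exact: dot_swap.
  exact: dot_map_linear.
exact: dot_map_bij.
Qed.

End FreeCalculus.

(** * One-forms and two-forms of the calculus of commuting derivations *)

Section Forms.
Context (K : fieldType) (A : algType K) (n : nat) (D : 'I_n -> {linear A -> A}).
Context (D_der : forall i, derivation (D i)).
Context (D_comm : forall i j a, D i (D j a) = D j (D i a)).
Context (two : 2%:R != 0 :> K).
Context (S T : 'I_n -> A) (TS : forall i j, T i * D j (S i) = (i == j)%:R).

Notation Om := (ext_calculus D_der D_comm two TS).

Definition form_val k (x : forms Om k) : ext A n := val (x : ext_comp A n k).

Lemma form_val_inj k : injective (@form_val k).
Proof. exact: val_inj. Qed.

Fact form_val_additive k : zmod_morphism (@form_val k).
Proof. by []. Qed.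

HB.instance Definition _ k := GRing.isZmodMorphism.Build
  (forms Om k) (ext A n) (@form_val k) (@form_val_additive k).

Lemma form_val_ract k (x : forms Om k) a :
  form_val (x *:r a) = form_val x * mono set0 a.
Proof. by []. Qed.

Lemma form_val_lact k (x : forms Om k) a :
  form_val (a *:l x) = mono set0 a * form_val x.
Proof. by []. Qed.

Lemma form_val_wedge2 (x y : forms Om 1) :
  form_val (wedge2 (x \otimes y)) = form_val x * form_val y.
Proof. by rewrite wedge2_tens. Qed.

Lemma form_val_dform (x : forms Om 1) :
  form_val (dform x) = ext_diff D (form_val x).
Proof. by []. Qed.

(** The right action multiplies coefficients, so the coordinates of a form are its values at the
    k-subsets, which [f] enumerates. It serves for singletons in degree 1 and for pairs p < q in
    degree 2. *)
Lemma form_basis k (I : finType) (f : I -> {set 'I_n}) (b : I -> forms Om k) :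
  injective f -> (forall i, #|f i| = k) ->
  (forall s : {set 'I_n}, #|s| = k -> exists i, s = f i) ->
  (forall i, form_val (b i) = mono (f i) 1) -> is_basis b.
Proof.
move=> f_inj f_card f_surj b_val.
have sum_val (c : I -> A^c) i : form_val (\sum_i c i *: b i) (f i) = c i.
  rewrite raddf_sum sum_ffunE (bigD1 i) //= big1 => [|j ji].
    by rewrite form_val_ract b_val mul_mono0E monoE eqxx mul1r addr0.
  rewrite form_val_ract b_val mul_mono0E monoE ifN ?mul0r //.
  by apply: contra_neq ji => /f_inj.
split=> [x|c c0 i]; last by rewrite -(sum_val c) c0 raddf0 ffunE.
exists (fun i => form_val x (f i) : A^c); apply/form_val_inj/ffunP => s.
have [/f_surj [i ->]|sk] := eqVneq #|s| k; first by rewrite sum_val.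
have vanish (y : forms Om k) : form_val y s = 0.
  by have /homogP := valP (y : ext_comp A n k); apply.
by rewrite !vanish.
Qed.

Definition form_e (i : 'I_n) : forms Om 1 :=
  (Sub (eps A i) (eps_homog A i) : ext_comp A n 1).

Lemma form_val_e i : form_val (form_e i) = eps A i.
Proof. by []. Qed.

Lemma form_e_basis : is_basis form_e.
Proof.
apply: (@form_basis _ _ (fun i => [set i])) => //; first exact: set1_inj.
  by move=> i; exact: cards1.
by move=> s /eqP/cards1P.
Qed.

Lemma form_e_central i : form_e i \in @central A (forms Om 1).
Proof.
apply/asboolP => a; apply/form_val_inj/ffunP => s.
rewrite form_val_ract form_val_lact mono0_mulE mul_mono0E monoE.
by case: ifP => _; rewrite ?mul1r ?mulr1 ?mul0r ?mulr0.
Qed.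

Lemma dform_e i : dform (form_e i) = 0.
Proof.
apply: form_val_inj; rewrite form_val_dform raddf0.
by rewrite /ext_diff big1 // => j _; rewrite ext_der_eps // mulr0.
Qed.

Lemma wedge_e_val (p q : 'I_n) : (p < q)%N ->
  form_val (wedge2 (form_e p \otimes form_e q)) = mono [set p; q] 1.
Proof.
move=> pq; rewrite form_val_wedge2 mono_mulE /mono_mul disjoints1 inE.
by rewrite -val_eqE /= (ltn_eqF pq) inversions1 ltnNge ltnW //= !mul1r.
Qed.

Lemma wedge_e_basis : is_basis (wedge_basis form_e (@wedge2 K A Om)).
Proof.
apply: (@form_basis _ _ (fun pq => [set (val pq).1; (val pq).2])).
- move=> [[p q] /= pq] [[p' q'] /= pq'] /= eq_set; apply: val_inj => /=.
  have /set2P p_in : p \in [set p'; q'] by rewrite -eq_set !inE eqxx.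
  have /set2P q_in : q \in [set p'; q'] by rewrite -eq_set !inE eqxx orbT.
  case: p_in pq => ->; case: q_in => -> //; rewrite ?ltnn //.
  by rewrite ltnNge ltnW.
- by move=> [[p q] /= pq]; rewrite cards2 -val_eqE /= (ltn_eqF pq).
- move=> s /eqP/cards2P [p [q [pq ->]]].
  have [pq'|qp|/val_inj] := ltngtP p q; last by move/eqP; rewrite (negPf pq).
    by exists (exist _ (p, q) pq').
  by exists (exist _ (q, p) qp); rewrite /= setUC.
- by move=> [[p q] /= pq]; exact: wedge_e_val.
Qed.

Lemma wedge_alt i j : wedge2 (form_e j \otimes form_e i) =
  - wedge2 (form_e i \otimes form_e j).
Proof.
apply: form_val_inj.
by rewrite raddfN /= !form_val_wedge2 !form_val_e eps_anticomm.
Qed.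

(** Since d e_q = 0, d(e_q a_q) = - e_q da_q is the sum over p of e_p e_q D_p(a_q); anticommutation
    folds the terms with q < p onto those with p < q. *)
Lemma dform_formula (a : 'I_n -> A) :
  dform (\sum_i form_e i *:r a i) =
  \sum_(p < n) \sum_(q < n | (p < q)%N)
    wedge2 (form_e p \otimes form_e q) *:r (D p (a q) - D q (a p)).
Proof.
apply: form_val_inj; rewrite form_val_dform !raddf_sum /=.
pose G p q : ext A n := eps A p * eps A q * mono set0 (D p (a q)).
have -> : \sum_i ext_diff D (form_val (form_e i *:r a i)) = \sum_p \sum_q G p q.
  rewrite [RHS]exchange_big; apply: eq_bigr => i _.
  rewrite form_val_ract form_val_e (ext_diffM D_der _ (eps_homog A i)).
  rewrite -[X in ext_diff D X]form_val_e -form_val_dform dform_e.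
  rewrite raddf0 mul0r add0r.
  rewrite mulr_sumr scaler_sumr; apply: eq_bigr => j _.
  by rewrite ext_der_mono expr1 scaleN1r mulrA -mulNr -eps_anticomm.
have Gpp p : G p p = 0.
  by rewrite /G mono_mulE /mono_mul disjoints1 inE eqxx mul0r.
have GE p q : form_val (wedge2 (form_e p \otimes form_e q) *:r
    (D p (a q) - D q (a p))) = G p q + G q p.
  rewrite form_val_ract form_val_wedge2 linearB mulrBr /G !form_val_e.
  by rewrite -mulNr -eps_anticomm.
under [RHS]eq_bigr => p _.
  rewrite raddf_sum /=; under eq_bigr do rewrite GE.
  rewrite big_split; over.
(* Renaming turns [G q p] for p < q into [G p q] for q < p; with the vanishing diagonal this
   completes the full double sum. *)
rewrite big_split /= [X in _ + X](exchange_big_dep xpredT) //= -big_split.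
apply: eq_bigr => p _; rewrite (bigID (fun q : 'I_n => (p < q)%N)) /=.
congr (_ + _); rewrite (bigD1 p) ?ltnn //= Gpp add0r; apply: eq_bigl => q.
by rewrite -leqNgt andbC -val_eqE /= -ltn_neqAle.
Qed.

End Forms.

(** * Derivations of the algebra generated by isometries *)

Section Generated.
Context (R : realType) (A : cstarAlgType R) (n : nat) (S : 'I_n -> A).

Lemma star1 : star (1 : A) = 1.
Proof. by have := starM (star (1 : A)) 1; rewrite mulr1 starK mulr1 => <-. Qed.

(* Closure under star is not a hypothesis: the induction carries P for both x
   and star x. *)
Lemma gen_alg_ind (P : gen_alg S -> Prop) :
  P 1 -> (forall (c : R[i]) x y, P x -> P y -> P (c *: x + y)) ->
  (forall x y, P x -> P y -> P (x * y)) ->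
  (forall i, P (gen S i)) -> (forall i, P (gen_star (gen S i))) ->
  forall x, P x.
Proof.
move=> P1 PL PM Pg Pgs x.
pose Q (y : A) := exists2 x : gen_alg S, P x & val x = y.
suff [[y Py yE] _] : Q (val x) /\ Q (star (val x)) by rewrite -(val_inj yE).
have /asboolP/(_ (fun y => Q y /\ Q (star y))) := valP x; apply.
  split.
  - by split; [exists 1|rewrite star1; exists 1].
  - move=> c y z [[y1 Py1 <-] [y2 Py2 y2E]] [[z1 Pz1 <-] [z2 Pz2 z2E]].
    split; first by exists (c *: y1 + z1); first exact: PL.
    exists (Num.conj c *: y2 + z2); first exact: PL.
    by rewrite starD starZ -y2E -z2E.
  - move=> y z [[y1 Py1 <-] [y2 Py2 y2E]] [[z1 Pz1 <-] [z2 Pz2 z2E]].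
    split; first by exists (y1 * z1); first exact: PM.
    exists (z2 * y2); first exact: PM.
    by rewrite starM -y2E -z2E.
  - by move=> y [Qy Qsy]; rewrite starK.
by move=> i; split; [exists (gen S i)|exists (gen_star (gen S i))].
Qed.

Context (D : 'I_n -> {linear gen_alg S -> gen_alg S}).
Context (D_derivation : forall i, derivation (D i)).
Context (D_gen : forall i j, D i (gen S j) = gen S i *+ (i == j)).
Context (D_gen_star : forall i j,
  D i (gen_star (gen S j)) = - (gen_star (gen S j) *+ (i == j))).

(** Every generator is a common eigenvector of all the derivations, with eigenvalue 0, 1 or -1. In a
    product, the two cross terms are exchanged when i and j are. *)
Lemma gen_der_comm i j a : D i (D j a) = D j (D i a).
Proof.
move: a; apply: gen_alg_ind => [|c x y Px Py|x y Px Py|k|k].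
- by rewrite !der1 // !linear0.
- by rewrite !linearP Px Py.
- rewrite !D_derivation !linearD /= !D_derivation Px Py.
  by rewrite -!addrA; congr (_ + _); rewrite addrCA.
- have Dk l : D l (gen S k) = gen S k *+ (l == k).
    by rewrite D_gen; case: eqP => // ->.
  by rewrite !Dk !linearMn !Dk -!mulrnA mulnC.
- rewrite !D_gen_star !linearN !linearMn /= !D_gen_star !mulNrn !opprK.
  by rewrite -!mulrnA mulnC.
Qed.

Context (S_isometry : forall i, star (S i) * S i = 1).

Lemma gen_isometry i : gen_star (gen S i) * gen S i = 1.
Proof. by apply: val_inj; rewrite /= S_isometry. Qed.

Lemma gen_star_der_gen i j : gen_star (gen S i) * D j (gen S i) = (i == j)%:R.
Proof.
rewrite D_gen eq_sym; case: eqP => [->|_]; last by rewrite mulr0.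
exact: gen_isometry.
Qed.

(** Only i = q contributes. As p differs from q, D_p kills S_q^* , and the factor S_q^* S_q = 1 left
    over disappears. This converts [dform_formula] into the formula of the theorem. *)
Lemma sum_der_gen p q (a : 'I_n -> gen_alg S) : p != q ->
  \sum_i D p (a i * gen_star (gen S i)) * D q (gen S i) = D p (a q).
Proof.
move=> pq; rewrite (bigD1 q) //= big1 => [|i /negPf iq].
  rewrite addr0 D_gen eqxx mulr1n D_derivation D_gen_star (negPf pq).
  by rewrite mulr0n oppr0 mulr0 addr0 -mulrA gen_isometry mulr1.
by rewrite D_gen eq_sym iq mulr0.
Qed.

End Generated.

Theorem theorem3p1 (R : realType) (A : cstarAlgType R) (n : nat)
  (S : 'I_n -> A)
  (S_isometry : forall i, star (S i) * S i = 1)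
  (S_generates : generates_cstar S)
  (D : 'I_n -> {linear gen_alg S -> gen_alg S})
  (D_derivation : forall i, derivation (D i))
  (D_gen : forall i j, D i (gen S j) = gen S i *+ (i == j))
  (D_gen_star : forall i j,
     D i (gen_star (gen S j)) = - (gen_star (gen S j) *+ (i == j))) :
  exists (Om : calculus (gen_alg S)) (Q : quasi_tame Om),
    tame Q /\
    exists e : 'I_n -> forms Om 1,
      [/\ [/\ is_basis e,
              forall i, e i \in @central (gen_alg S) (forms Om 1) &
              forall i, dform (e i) = 0],
          is_basis (fun pq : {pq : 'I_n * 'I_n | (pq.1 < pq.2)%N} =>
                      wedge2 (e (val pq).1 \otimes e (val pq).2)),
          forall a : 'I_n -> gen_alg S,
            dform (\sum_(i < n) e i *:r a i) =
            \sum_(p < n) \sum_(q < n | (p < q)%N)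
              wedge2 (e p \otimes e q) *:r
              (\sum_(i < n)
                 (D p (a i * gen_star (gen S i)) * D q (gen S i)
                  - D q (a i * gen_star (gen S i)) * D p (gen S i))) &
          exists g0 : {linear tensor (forms Om 1) (forms Om 1)
                         -> regbim (gen_alg S)},
            [/\ pseudo_riemannian Q g0,
                bilinear_metric g0 &
                forall i j,
                  g0 (e i \otimes e j) = (i == j)%:R :> gen_alg S]].
Proof.
have D_comm := gen_der_comm D_derivation D_gen D_gen_star.
have two : 2%:R != 0 :> R[i] by rewrite pnatr_eq0.
have TS := gen_star_der_gen D_gen S_isometry.
exists (ext_calculus D_derivation D_comm two TS).
have w_alt := wedge_alt D_derivation D_comm two TS.
have w_basis := wedge_e_basis D_derivation D_comm two TS.
exists (free_quasi_tame two (form_e_basis _ _ _ _) (form_e_central _ _ _ _)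
  w_alt w_basis).
split; first exact: free_tame.
exists (form_e D_derivation D_comm two TS); split.
- split; [exact: form_e_basis | exact: form_e_central | exact: dform_e].
- exact: w_basis.
- move=> a; rewrite dform_formula.
  apply: eq_bigr => p _; apply: eq_bigr => q pq; congr (_ *: _).
  have pq' : p != q by rewrite -val_eqE /= (ltn_eqF pq).
  by rewrite sumrB !sum_der_gen // eq_sym.
exists (dot (form_e_basis D_derivation D_comm two TS)
  (form_e_central D_derivation D_comm two TS)); split.
- exact: dot_pseudo_riemannian.
- exact: dot_lact.
- exact: dot_basis.
Qed.
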